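(* For every $R^-,R^+\in SO(2)$ and for every $\varepsilon>0$ there exist $l=l(R^-,R^+)>0$, $h=h(R^-,R^+)>0$ and a field $A_\varepsilon\in L^1_{loc}(\mathbb{R}^2;\mathbb{R}^{2\times2})$ such that $$A_\varepsilon(x)=I_{R^-,R^+}(x)\qquad\forall\,x\in\mathbb{R}^2\setminus\big((-l/2,l/2)\times\mathbb{R}\big)$$ and $$F_\varepsilon(A_\varepsilon,Q_L)\le CL|R^--R^+|\big(\big|\log|R^--R^+|\big|+1\big)\qquad\forall\,L>h,$$ where $C>0$ is a dimensional constant. In particular, $$\psi_\infty(R^-,R^+)\le C|R^--R^+|\big(\big|\log|R^--R^+|\big|+1\big)\qquad\forall\,R^-,R^+\in SO(2).$$
   Context: Notation: $Q_r=(-r,r)\times(-r,r)$ and $I_{R^-,R^+}(x):=R^-\chi_{\{x_1<0\}}(x)+R^+\chi_{\{x_1\ge0\}}(x)$. Expressions $t|\log t|$ are read as $0$ at $t=0$. Model. Fix parameters $\lambda,\tau>0$ (the constant $C$ may depend on them). For $\varepsilon>0$ and a bounded open set $\Omega\subset\mathbb{R}^2$, $\mathcal{C}_\varepsilon(\Omega)$ is the set of pairs $(A,S)$ with $A\in L^1(\Omega;\mathbb{R}^{2\times2})$ and $S\subset\Omega$ relatively closed such that: (a) $S\supseteq\mathrm{supp}(\mathrm{Curl}\,A)$, where $\mathrm{Curl}\,A$ is the row-wise distributional curl; (b) for every simple rectifiable closed curve $\gamma$ in $\Omega\setminus S$ one has $\int_\gamma A\in\tau\varepsilon\mathbb{Z}^2$.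 Here $\int_\gamma A:=-\mathrm{sgn}(\gamma)\int_\Omega A\,\nabla^\perp\varphi\,dx$, where $D\subset\Omega$ is the open set with $\gamma=\partial D$, $\mathrm{sgn}(\gamma)=+1$ if $\gamma$ is anticlockwise and $-1$ if clockwise, $\varphi\in C_c^\infty(\Omega)$ is any function with $\varphi=1$ on $D$ and $(\mathrm{supp}\,\varphi)\setminus D\subset\Omega\setminus S$, and $\nabla^\perp\varphi=(\partial_2\varphi,-\partial_1\varphi)$ (this does not depend on $\varphi$ and is the usual line integral for continuous $A$). Energy. For $(A,S)\in\mathcal{C}_\varepsilon(\Omega)$, $$\mathcal{F}_\varepsilon(A,S;\Omega):=\int_{\Omega\setminus B_{\lambda\varepsilon}(S)}\mathrm{dist}^2(A(x),SO(2))\,dx+|B_{\lambda\varepsilon}(S)|,$$ where $B_{\lambda\varepsilon}(S):=\{x\in\Omega:\mathrm{dist}(x,S)<\lambda\varepsilon\}$ and $|\cdot|$ is Lebesgue measure (Euclidean/Frobenius norm on matrices). For a field $A\in L^1_{loc}(\mathbb{R}^2;\mathbb{R}^{2\times2})$ and an open square $Q$, $F_\varepsilon(A,Q):=\frac1\varepsilon\inf\{\mathcal{F}_\varepsilon(A,S;Q):(A|_Q,S)\in\mathcal{C}_\varepsilon(Q)\}$. Thermodynamic limit. $\psi(R^-,R^+,L):=\inf\{F_1(A,Q_L):A\in L^1_{loc}(\mathbb{R}^2;\mathbb{R}^{2\times2}),\ A=I_{R^-,R^+}\text{ in }\mathbb{R}^2\setminus Q_{L'}\text{ for some }L'<L\}$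 and $\psi_\infty(R^-,R^+):=\lim_{L\to+\infty}\frac1{2L}\psi(R^-,R^+,L)$ (this limit exists).
   Formalization: Here l and h may depend on ε as well as on R⁻,R⁺: with l,h independent of ε the claim fails as ε→∞ (take L=λε and a small angle); rescaling the case ε=1 gives l=εl₁, h=εh₁, hence uniform l,h for bounded ε. *)

(* Defs.v *)
From HB Require Import structures.
From mathcomp Require Import all_boot all_order all_algebra.
From mathcomp Require Import all_classical all_reals all_analysis.

Set Implicit Arguments.
Unset Strict Implicit.
Unset Printing Implicit Defensive.

Import Order.TTheory GRing.Theory Num.Theory.
Import numFieldNormedType.Exports.

Local Open Scope classical_set_scope.
Local Open Scope ring_scope.

(* The plane is R * R. Its library norm is the sup norm, and so is the one of  *)
(* 'M[R]_2; the Euclidean and Frobenius norms below are therefore defined by   *)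
(* hand (the topologies agree).                                               *)

Definition leb2 (R : realType) :
    {measure set (measurableTypeR R * measurableTypeR R) -> \bar R} :=
  (@lebesgue_measure R \x @lebesgue_measure R)%E.

Definition enorm (R : realType) (x : R * R) : R :=
  Num.sqrt (x.1 ^+ 2 + x.2 ^+ 2).

Definition frob (R : realType) (M : 'M[R]_2) : R :=
  Num.sqrt (\sum_i \sum_j M i j ^+ 2).

Definition SO2 (R : realType) : set 'M[R]_2 :=
  [set M | M^T *m M = 1%:M /\ \det M = 1].

Definition dist_SO2 (R : realType) (M : 'M[R]_2) : R :=
  inf [set frob (M - B) | B in @SO2 R].

Definition square (R : realType) (r : R) : set (R * R) :=
  `]- r, r[ `*` `]- r, r[.

(* The field I_{R^-,R^+}. *)
Definition two_rot (R : realType) (Rm Rp : 'M[R]_2) (x : R * R) : 'M[R]_2 :=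
  if x.1 < 0 then Rm else Rp.

Definition frontier (T : topologicalType) (D : set T) : set T :=
  closure D `\` interior D.

(* L^1 and L^1_loc fields are represented by Borel functions. *)
Definition L1 (R : realType) (Omega : set (R * R)) (A : R * R -> 'M[R]_2) :=
  forall i j, (@leb2 R).-integrable Omega (fun x => (A x i j)%:E).

Definition L1loc (R : realType) (A : R * R -> 'M[R]_2) :=
  forall K : set (R * R), compact K -> L1 K A.

Definition partial1 (R : realType) (f : R * R -> R) : R * R -> R :=
  fun x => 'D_((1, 0) : R * R) f x.

Definition partial2 (R : realType) (f : R * R -> R) : R * R -> R :=
  fun x => 'D_((0, 1) : R * R) f x.

Fixpoint Ck (R : realType) (k : nat) (f : R * R -> R) : Prop :=
  if k is k'.+1 then
    [/\ forall x, derivable f x ((1, 0) : R * R),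
        forall x, derivable f x ((0, 1) : R * R),
        Ck k' (partial1 f) & Ck k' (partial2 f)]
  else continuous f.

Definition supp (R : realType) (phi : R * R -> R) : set (R * R) :=
  closure [set x | phi x != 0].

Definition test_function (R : realType) (Omega : set (R * R))
    (phi : R * R -> R) : Prop :=
  [/\ forall k, Ck k phi, compact (supp phi) & supp phi `<=` Omega].

Definition grad_perp (R : realType) (phi : R * R -> R) (x : R * R) : 'cV[R]_2 :=
  \col_i (if i == 0 then partial2 phi x else - partial1 phi x).

(* The vector \int_Omega A grad_perp(phi). With                               *)
(* (Curl A)_i = d_1 A_{i2} - d_2 A_{i1} it is also <Curl A, phi>.              *)
Definition curl_pairing (R : realType) (Omega : set (R * R))
    (A : R * R -> 'M[R]_2) (phi : R * R -> R) : 'cV[R]_2 :=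
  \col_i Rintegral (@leb2 R) Omega (fun x => (A x *m grad_perp phi x) i 0).

(* Support of the distribution Curl A on Omega. *)
Definition supp_curl (R : realType) (Omega : set (R * R))
    (A : R * R -> 'M[R]_2) : set (R * R) :=
  [set x | Omega x /\ forall U : set (R * R), open U -> U x -> U `<=` Omega ->
     exists2 phi, test_function U phi & curl_pairing Omega A phi != 0].

(* Curves are parametrized by [0, 1]. *)
Definition length_sums (R : realType) (gamma : R -> R * R) : set R :=
  [set (let p := nth 1 (0 :: s) in
        \sum_(0 <= n < size s) enorm (gamma (p n.+1) - gamma (p n)))
  | s in itv_partition 0 1].

Definition simple_rectifiable_closed (R : realType) (gamma : R -> R * R) :=
  [/\ {within `[0, 1], continuous gamma},
      gamma 0 = gamma 1,
      {in `[0, 1[ &, injective gamma} &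
      has_ubound (length_sums gamma)].

Definition trace_of (R : realType) (gamma : R -> R * R) : set (R * R) :=
  gamma @` `[0, 1].

(* gamma has winding number n around z, by a continuous choice of the angle.  *)
Definition has_winding (R : realType) (gamma : R -> R * R) (z : R * R)
    (n : int) : Prop :=
  exists theta : R -> R,
    [/\ {within `[0, 1], continuous theta},
        forall t, t \in `[0, 1] ->
          gamma t - z = (enorm (gamma t - z) * cos (theta t),
                         enorm (gamma t - z) * sin (theta t)) &
        theta 1 - theta 0 = 2 * pi * n%:~R].

Definition anticlockwise (R : realType) (gamma : R -> R * R)
    (D : set (R * R)) : Prop :=
  forall z, D z -> has_winding gamma z 1.

Definition sgn_curve (R : realType) (gamma : R -> R * R)
    (D : set (R * R)) : R :=
  if `[< anticlockwise gamma D >] then 1 else -1.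

(* \int_gamma A, computed with the domain D enclosed by gamma and the cutoff  *)
(* phi.                                                                       *)
Definition curve_integral (R : realType) (Omega : set (R * R))
    (A : R * R -> 'M[R]_2) (gamma : R -> R * R) (D : set (R * R))
    (phi : R * R -> R) : 'cV[R]_2 :=
  - sgn_curve gamma D *: curl_pairing Omega A phi.

Definition lattice (R : realType) (a : R) : set 'cV[R]_2 :=
  [set a *: map_mx intr z | z in [set: 'cV[int]_2]].

Definition rel_closed (R : realType) (Omega S : set (R * R)) : Prop :=
  exists2 F : set (R * R), closed F & S = Omega `&` F.

(* The class C_eps(Omega); tau is the lattice parameter. *)
Definition admissible (R : realType) (tau eps : R) (Omega : set (R * R))
    (A : R * R -> 'M[R]_2) (S : set (R * R)) : Prop :=
  [/\ L1 Omega A,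
      rel_closed Omega S,
      supp_curl Omega A `<=` S &
      forall gamma : R -> R * R,
        simple_rectifiable_closed gamma ->
        trace_of gamma `<=` Omega `\` S ->
      forall D : set (R * R),
        open D -> D `<=` Omega -> frontier D = trace_of gamma ->
      forall phi,
        test_function Omega phi ->
        (forall x, D x -> phi x = 1) ->
        supp phi `\` D `<=` Omega `\` S ->
      lattice (tau * eps) (curve_integral Omega A gamma D phi)].

(* dist(x, S), equal to +oo when S is empty. *)
Definition dist_set (R : realType) (x : R * R) (S : set (R * R)) : \bar R :=
  ereal_inf [set (enorm (x - y))%:E | y in S].

Definition nbhd (R : realType) (Omega : set (R * R)) (r : R)
    (S : set (R * R)) : set (R * R) :=
  [set x | Omega x /\ (dist_set x S < r%:E)%E].

Definition energy (R : realType) (lambda eps : R) (Omega : set (R * R))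
    (A : R * R -> 'M[R]_2) (S : set (R * R)) : \bar R :=
  ((\int[@leb2 R]_(x in Omega `\` nbhd Omega (lambda * eps) S)
      (dist_SO2 (A x) ^+ 2)%:E)
   + leb2 R (nbhd Omega (lambda * eps) S))%E.

(* F_eps(A, Q); +oo if no S is admissible. *)
Definition Feps (R : realType) (lambda tau eps : R) (A : R * R -> 'M[R]_2)
    (Q : set (R * R)) : \bar R :=
  ((eps^-1)%:E *
   ereal_inf [set energy lambda eps Q A S | S in admissible tau eps Q A])%E.

Definition psi (R : realType) (lambda tau : R) (Rm Rp : 'M[R]_2) (L : R) :
    \bar R :=
  ereal_inf [set Feps lambda tau 1 A (square L) | A in
    [set A | L1loc A /\ exists2 L' : R, L' < L &
       forall x, ~ square L' x -> A x = two_rot Rm Rp x]].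

Definition psi_oo (R : realType) (lambda tau : R) (Rm Rp : 'M[R]_2) : \bar R :=
  lim ((((2 * L)^-1)%:E * psi lambda tau Rm Rp L)%E @[L --> +oo%R]).

(* Main.v *)
Require Import Defs.
From HB Require Import structures.
From mathcomp Require Import all_boot all_order all_algebra.
From mathcomp Require Import all_classical all_reals all_analysis.
From mathcomp Require Import measurable_realfun.
From mathcomp Require Import ring lra zify.
Import Order.TTheory GRing.Theory Num.Theory.
Import numFieldNormedType.Exports.
Set Implicit Arguments.
Unset Strict Implicit.
Unset Printing Implicit Defensive.
Local Open Scope classical_set_scope.
Local Open Scope ring_scope.

(** Put [q := (Rp - Rm) i 1] and [theta := |Rm - Rp|]. The distance of [A x] to
    [SO2] is at most its distance to [Rm] for [x.1 < 0] and to [Rp] for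
    [0 <= x.1], so the energy is bounded by the squared L2 distance of [A] to
    the two-rotation field, and the rows of [A] may be built independently
    ([two_rows_Feps]). In row [i], the jump of the first entry across
    [x.1 = 0] is tangentially invisible and free of curl; the jump [q] of the
    second entry carries curl with density [q] on that line, which has to be
    concentrated into charges [+-tau * eps], one for each cell of height
    [2 * w = tau * eps / |q|].

    In a cell around [(0, c)] the row is the gradient of
    [q * w * (x.2 - c) / x.1] on the cone [|x.2 - c| <= x.1 < w], the constant
    [(0, q)] for [w <= x.1], and zero elsewhere. The rays from the apex
    to the points [(w, z)] carry equal amounts of this field: slicing vertically,
    substituting the height by the end point [z] of the ray and integrating the
    derivative of a test function [f] along each ray gives
    [2 * w * q * f (0, c)] minus the flux of [q] through [x.1 = w]
    ([pairing_cone]), and the constant part returns that flux ([pairing_strip]).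
    Hence the curl of a cell is a point charge [2 * q * w = +-tau * eps]
    ([pairing_cell]). The field has size [|q| * w / r] at distance [r] from the
    apex, so that, off a disc of radius [lambda * eps], the cell costs
    [4 * (q * w) ^ 2 * ln (2 * w / (lambda * eps))] plus a bounded multiple of
    [eps ^ 2] ([integral_cone_energy]); the logarithm is [|ln |q|| + O(1)].
    Multiplying by the number [L * |q| / (tau * eps)] of cells and dividing by
    [eps] gives [L * |q| * (1 + |ln |q||)], and [t * (1 + |ln t|)] is increasing
    ([mulr_norm_ln_le]), so [|q|] may be replaced by [theta].

    Admissibility needs only the formula for the pairing with a test function
    [phi] ([pairing_wallN_sing]). If [phi = 1] on [D] and [supp phi] minus [D]
    avoids the singular set, then [phi] takes the values 0 and 1 on the singular
    set, so the pairing is an integer combination of the charges; nothing has to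
    be known about Jordan curves ([two_rows_admissible]).

    For [psi] the field has to be the two-rotation field outside a smaller square.
    Cells do not interact, so all cells above some height [Y] just below [L] may
    be replaced by the bare jump, the two half-lines above [Y] and below [- Y]
    becoming singular. A continuous [phi] with values 0 and 1 on such
    a half-line, vanishing near its far end, vanishes on all of it, hence
    these half-lines carry no circulation; their neighbourhood has bounded
    area, negligible against [L] ([finite_wall]). The same construction
    restricted to the square of size [L] with [L <= Y] gives the first claim
    ([infinite_wall]). *)

(** * Measurability and continuity in the plane *)

(** The integral of a nonnegative function is a supremum over the simple functions
    below it, hence monotone for arbitrary functions and domains. This avoids
    discussing the measurability of the distance to [SO2]. *)
Lemma ge0_le_integral_subset d (T : measurableType d) (R : realType)
    (mu : {measure set T -> \bar R}) (D E : set T) (f g : T -> \bar R) :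
  (forall x, D x -> E x /\ (0 <= f x <= g x)%E) ->
  (forall x, E x -> 0 <= g x)%E ->
  (\int[mu]_(x in D) f x <= \int[mu]_(x in E) g x)%E.
Proof.
move=> fg g0.
rewrite ge0_integralE; last by move=> x /fg[_ /andP[]].
rewrite ge0_integralE//.
apply: le_ereal_sup => _ [h hf <-]; exists h => // x.
apply: (le_trans (hf x)); rewrite !patchE.
case: ifPn => xD; case: ifPn => xE //.
- by move/set_mem: xD => /fg [_ /andP[]].
- by move/set_mem: xD => /fg [Ex _]; move: xE; rewrite mem_set.
- by move/set_mem: xE => /g0.
Qed.

(** An open set is a countable union of squares with rational centre and radius
    [1 / (n + 1)], and these are measurable rectangles. *)
Lemma measurable_open2 (R : realType) (U : set (R * R)) :
  open U -> measurable (U : set (measurableTypeR R * measurableTypeR R)).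
Proof.
move=> oU.
pose I (p : rat) (n : nat) : set R := ball (ratr p : R) (n.+1%:R^-1).
pose V p q n : set (R * R) :=
  [set x | (I p n `*` I q n) x /\ I p n `*` I q n `<=` U].
have -> : U = \bigcup_(p : rat) \bigcup_(q : rat) \bigcup_(n : nat) V p q n.
  apply/seteqP; split => [[x y] Uxy|x [p _ [q _ [n _ [Vx]]]]]; last exact.
  have /nbhs_ballP[e /= e0 eU] : nbhs (x, y) U by exact: open_nbhs_nbhs.
  pose n := Num.truncn (2 / e); pose d : R := n.+1%:R^-1.
  have d0 : 0 < d by rewrite invr_gt0.
  have de : d + d <= e.
    have : 2 / e < n.+1%:R by rewrite truncnS_gt.
    rewrite ltr_pdivrMr// => h.
    rewrite (_ : d + d = 2 / n.+1%:R); last by rewrite mulr_natl mulr2n.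
    by rewrite ler_pdivrMr// mulrC ltW.
  have /rat_in_itvoo[p px] : x - d < x + d by lra.
  have /rat_in_itvoo[q qy] : y - d < y + d by lra.
  exists p => //; exists q => //; exists n => //; split.
    split => /=; rewrite /I /ball/= -/d ltr_distl.
      by move: px; rewrite in_itv/= => /andP[? ?]; apply/andP; split; lra.
    by move: qy; rewrite in_itv/= => /andP[? ?]; apply/andP; split; lra.
  move=> [u v] [/= Iu Iv]; apply: eU; split => /=.
    move: Iu px; rewrite /I /ball/= -/d !ltr_distl in_itv/=.
    by move=> /andP[? ?] /andP[? ?]; apply/andP; split; lra.
  move: Iv qy; rewrite /I /ball/= -/d !ltr_distl in_itv/=.
  by move=> /andP[? ?] /andP[? ?]; apply/andP; split; lra.
apply: bigcupT_measurable_rat => p; apply: bigcupT_measurable_rat => q.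
apply: bigcupT_measurable => n.
have [h|h] := pselect (I p n `*` I q n `<=` U).
  rewrite (_ : V p q n = I p n `*` I q n).
    by apply: measurableX; rewrite /I; apply: open_measurable; exact: ball_open.
  by apply/seteqP; split=> x; [case|].
rewrite (_ : V p q n = set0)//.
by apply/seteqP; split=> x // [].
Qed.

Lemma continuous_measurable2 (R : realType) (f : R * R -> R) :
  continuous f ->
  measurable_fun setT (f : measurableTypeR R * measurableTypeR R -> R).
Proof.
move=> /continuousP cf.
apply: (measurability _ (RGenOpens.measurableE R)).
move=> _ [_ [a [b ->] <-]]; rewrite setTI; apply: measurable_open2.
exact/cf/interval_open.
Qed.

Lemma continuous_comp2 (R : realType) (T : topologicalType) (h : R * R -> R)
    (u v : T -> R) : continuous h -> continuous u -> continuous v ->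
  continuous (fun t => h (u t, v t)).
Proof.
move=> ch cu cv t; apply: (@continuous_comp _ _ _ (fun t => (u t, v t)) h).
  exact: (cvg_pair (cu t) (cv t)).
exact: ch.
Qed.

Lemma continuous_slice1 (R : realType) (h : R * R -> R) (y : R) :
  continuous h -> continuous (fun x => h (x, y)).
Proof.
by move=> ch; apply: (continuous_comp2 ch) => x; [exact: cvg_id|exact: cvg_cst].
Qed.

Lemma continuous_slice2 (R : realType) (h : R * R -> R) (x : R) :
  continuous h -> continuous (fun y => h (x, y)).
Proof.
by move=> ch; apply: (continuous_comp2 ch) => y; [exact: cvg_cst|exact: cvg_id].
Qed.

Arguments continuous_slice1 {R h} y _ _.
Arguments continuous_slice2 {R h} x _ _.

(** * Compactly supported functions of class C1 *)

(** What is used of a test function [f]: its partial derivatives [d1], [d2] along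
    the axes, their continuity, and vanishing off [square M]. *)
Record C1c (R : realType) (M : R) (f d1 d2 : R * R -> R) : Prop := {
  C1c_cont : continuous f;
  C1c_cont1 : continuous d1;
  C1c_cont2 : continuous d2;
  C1c_der1 : forall x y : R, is_derive x (1 : R) (fun t : R => f (t, y)) (d1 (x, y));
  C1c_der2 : forall x y : R, is_derive y (1 : R) (fun t : R => f (x, t)) (d2 (x, y));
  C1c_off : forall x, ~ square M x -> [/\ f x = 0, d1 x = 0 & d2 x = 0] }.

Arguments C1c_cont {R M f d1 d2} _ _.
Arguments C1c_cont1 {R M f d1 d2} _ _.
Arguments C1c_cont2 {R M f d1 d2} _ _.

Lemma mean_value_signed (R : realType) (f df : R -> R) (t h : R) :
  (forall x : R, is_derive x (1 : R) f (df x)) ->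
  exists2 s, `|s - t| <= `|h| & f (t + h) - f t = h * df s.
Proof.
move=> fd.
have cf a b : {within `[a, b], continuous f}.
  apply: continuous_subspaceT => x.
  by apply: differentiable_continuous; apply/derivable1_diffP; case: (fd x).
have [h0|/ltW h0] := leP 0 h.
  have [||s] := @MVT_segment R f df t (t + h); rewrite ?lerDl//.
  rewrite in_itv/= => /andP[ts sh] ->; exists s; last by ring.
  by rewrite !ger0_norm//; lra.
have [||s] := @MVT_segment R f df (t + h) t; rewrite ?gerDl//.
rewrite in_itv/= => /andP[ts sh] e; exists s.
  by rewrite !ler0_norm//; lra.
by rewrite -[LHS]opprB e; ring.
Qed.

(** Chain rule for continuous partial derivatives: the increment along the line is
    a horizontal increment, to which the mean value theorem and the continuity of
    [d1] apply, plus a vertical one, the derivative of a one-variable composite. *)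
Lemma is_derive_ray (R : realType) (M : R) (f d1 d2 : R * R -> R) (c v t : R) :
  C1c M f d1 d2 ->
  is_derive t (1 : R) (fun s : R => f (s, c + v * s))
    (d1 (t, c + v * t) + v * d2 (t, c + v * t)).
Proof.
move=> F.
set l := (X in is_derive _ _ _ X).
pose g s := f (s, c + v * s).
suff H : (fun h => h^-1 *: (g (h *: 1 + t) - g t)) @ 0^' --> l.
  by apply: DeriveDef; [apply: cvgP H|exact: cvg_lim H].
pose A h := h^-1 *: (f (h + t, c + v * (h + t)) - f (t, c + v * (h + t))).
pose B h := h^-1 *: (f (t, c + v * (h + t)) - f (t, c + v * t)).
rewrite (_ : (fun _ => _) = A \+ B); last first.
  apply/funext => h; rewrite /A /B /g /= -scalerDr; congr (_ *: _).
  by rewrite /GRing.scale/= mulr1; ring.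
apply: cvgD.
  apply/cvgrPdist_le => /= e e0.
  have /cvgrPdist_le/(_ e e0) := C1c_cont1 F (t, c + v * t).
  move=> /nbhs_ballP[d /= d0 dP].
  pose k := `|v| + 1.
  have k0 : 0 < k by rewrite ltr_wpDl.
  near=> h.
  have h0 : h != 0 by near: h; exact: nbhs_dnbhs_neq.
  have hd : `|h| < d / k.
    by near: h; apply: dnbhs0_lt; exact: divr_gt0.
  have hk : `|h| * k < d by rewrite -ltr_pdivlMr.
  have [s st ->] : exists2 s, `|s - t| <= `|h| &
      A h = d1 (s, c + v * (h + t)).
    have [s st e1] := @mean_value_signed R (fun x => f (x, c + v * (h + t)))
      (fun x => d1 (x, c + v * (h + t))) t h (fun x => C1c_der1 F x _).
    exists s => //; rewrite [t + h]addrC in e1; rewrite /A e1.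
    by rewrite /GRing.scale/= mulrA mulVf// mul1r.
  apply: (dP (s, c + v * (h + t))); split; rewrite /ball/=.
    rewrite distrC (le_lt_trans st)// (le_lt_trans _ hk)//.
    by rewrite ler_peMr// /k lerDr.
  rewrite (_ : _ - _ = - (v * h)); last by ring.
  rewrite normrN normrM mulrC (le_lt_trans _ hk)//.
  by rewrite ler_wpM2l// /k lerDl.
have Daff : is_derive t (1 : R) (fun s : R => c + v * s) v.
  have -> : (fun s : R => c + v * s) = cst c + v \*: (@id R) by [].
  by apply: is_derive_eq; rewrite add0r /GRing.scale/= mulr1.
have := @is_derive1_comp R (fun s => f (t, s)) (fun s => c + v * s) t _ _
  (C1c_der2 F t (c + v * t)) Daff.
case=> dB; rewrite mulrC => <-; rewrite /derive /B.
move: dB; rewrite /derivable => /cvg_ex[l' hl'].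
rewrite (cvg_lim _ hl')//.
pose u : R -> R := (fun y : R => f (t, y)) \o (fun s : R => c + v * s).
rewrite (_ : (fun _ => _) = (fun h => h^-1 *: ((u \o shift t) (h *: 1) - u t)))//.
by apply/funext => h /=; rewrite /GRing.scale/= mulr1.
Unshelve. all: by end_near. Qed.

Lemma test_function_C1c (R : realType) (M : R) (phi : R * R -> R) :
  test_function (square M) phi -> C1c M phi (partial1 phi) (partial2 phi).
Proof.
move=> [sm cs sub].
have c0 := sm 0%N; have /= [dr1 dr2 c1 c2] := sm 1%N.
have off x : ~ square M x -> \forall y \near x, phi y = 0.
  move=> nx; have : nbhs x (~` supp phi).
    apply: open_nbhs_nbhs; split; last by move=> /sub.
    by apply: closed_openC; exact: closed_closure.
  apply: filterS => y ny; apply/eqP; apply: contra_notT ny => ny.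
  exact: subset_closure.
split=> //.
- move=> x y.
  have E : (fun h : R => h^-1 *: ((phi \o shift (x, y)) (h *: ((1, 0) : R * R)) - phi (x, y)))
      = (fun h : R => h^-1 *: (((fun t : R => phi (t, y)) \o shift x) (h *: (1 : R))
          - phi (x, y))).
    apply/funext => h /=; congr (_ *: (phi _ - _)).
    by congr pair; rewrite -[LHS]/(h * 0 + y) mulr0 add0r.
  split; first by have := dr1 (x, y); rewrite /derivable E.
  by rewrite /partial1 /derive E.
- move=> x y.
  have E : (fun h : R => h^-1 *: ((phi \o shift (x, y)) (h *: ((0, 1) : R * R)) - phi (x, y)))
      = (fun h : R => h^-1 *: (((fun t : R => phi (x, t)) \o shift y) (h *: (1 : R))
          - phi (x, y))).
    apply/funext => h /=; congr (_ *: (phi _ - _)).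
    by congr pair; rewrite -[LHS]/(h * 0 + x) mulr0 add0r.
  split; first by have := dr2 (x, y); rewrite /derivable E.
  by rewrite /partial2 /derive E.
- move=> x /off nx; split; first exact: nbhs_singleton nx.
    rewrite /partial1 (near_eq_derive _ (g := cst 0) _)//; exact: derive_cst.
  rewrite /partial2 (near_eq_derive _ (g := cst 0) _)//; exact: derive_cst.
Qed.

Lemma bounded_off_square (R : realType) (M : R) (f : R * R -> R) :
  continuous f -> (forall x, ~ square M x -> f x = 0) ->
  exists2 K, 0 < K & forall x, `|f x| <= K.
Proof.
move=> cf f0.
have cpt : compact (`[- M, M] `*` `[- M, M] : set (R * R)).
  by apply: compact_setX; exact: segment_compact.
have : compact (f @` (`[- M, M] `*` `[- M, M])).
  by apply: continuous_compact => //; exact: continuous_subspaceT.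
move=> /compact_bounded[K0 [_ /(_ (`|K0| + 1))]].
have -> : K0 < `|K0| + 1 by rewrite (le_lt_trans (ler_norm K0))// ltrDl.
move=> /(_ isT) h; exists (`|K0| + 1); first by rewrite ltr_wpDl.
move=> x; have [xM|xM] := pselect (square M x); last first.
  by rewrite f0// normr0 addr_ge0.
apply: (h (f x)); exists x => //; case: xM; split => /=; exact: subset_itv_oo_cc.
Qed.

(** * Fundamental theorem of calculus on segments and half-lines *)

Lemma ftc_segment (R : realType) (g dg : R -> R) (a b : R) : a <= b ->
  (forall x : R, is_derive x (1 : R) g (dg x)) -> continuous dg ->
  (\int[@lebesgue_measure R]_(r in `[a, b]) (dg r)%:E = (g b - g a)%:E)%E.
Proof.
rewrite le_eqVlt => /predU1P[<- _ _|ab gd cd].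
  by rewrite set_itv1 integral_set1 subrr.
have cg : continuous g.
  move=> x; apply: differentiable_continuous; apply/derivable1_diffP.
  by case: (gd x).
rewrite (@continuous_FTC2 _ dg g)//.
- exact: continuous_subspaceT.
- split.
  + by move=> x _; case: (gd x).
  + exact: cvg_at_right_filter (cg a).
  + exact: cvg_at_left_filter (cg b).
- by move=> x _; rewrite derive1E; case: (gd x).
Qed.

Lemma eq_integral_ext0 d (T : measurableType d) (R : realType)
    (mu : {measure set T -> \bar R}) (D E : set T) (f g : T -> \bar R) :
  (forall x, D x -> E x -> f x = g x) ->
  (forall x, D x -> ~ E x -> f x = 0%E) ->
  (forall x, ~ D x -> E x -> g x = 0%E) ->
  (\int[mu]_(x in D) f x = \int[mu]_(x in E) g x)%E.
Proof.
move=> fg f0 g0; rewrite integral_mkcond [RHS]integral_mkcond.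
apply: eq_integral => x _; rewrite !patchE.
case: ifPn => [/set_mem|/negP]; rewrite ?in_setE; case: ifPn => [/set_mem|/negP];
  rewrite ?in_setE //; auto.
by move=> ? ?; apply/esym; auto.
Qed.

Lemma ftc_halfline (R : realType) (g dg : R -> R) (s M : R) :
  (forall x : R, is_derive x (1 : R) g (dg x)) -> continuous dg ->
  (forall x, M <= x -> g x = 0 /\ dg x = 0) ->
  (\int[@lebesgue_measure R]_(r in `[s, +oo[) (dg r)%:E = (- g s)%:E)%E.
Proof.
move=> gd cd g0.
pose N := Num.max s M.
have sN : s <= N by rewrite le_max lexx.
have MN : M <= N by rewrite le_max lexx orbT.
transitivity (\int[@lebesgue_measure R]_(r in `[s, N]) (dg r)%:E)%E.
  apply: eq_integral_ext0 => // x /=; rewrite !in_itv/= andbT.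
    move=> sx; rewrite sx => /negP; rewrite -ltNge => /ltW Nx.
    by rewrite (g0 x (le_trans MN Nx)).2.
  by move=> /negP/negbTE ->.
by rewrite (ftc_segment sN gd cd) (g0 N MN).1 sub0r.
Qed.

Lemma ftc_line (R : realType) (g dg : R -> R) (M : R) :
  (forall x : R, is_derive x (1 : R) g (dg x)) -> continuous dg ->
  (forall x, M <= `|x| -> g x = 0 /\ dg x = 0) ->
  (\int[@lebesgue_measure R]_r (dg r)%:E = 0)%E.
Proof.
move=> gd cd g0.
transitivity (\int[@lebesgue_measure R]_(r in `[(- `|M|)%R, +oo[) (dg r)%:E)%E.
  apply: eq_integral_ext0 => // x; last by move/(_ I).
  move=> _ /=; rewrite !in_itv/= andbT => /negP.
  rewrite -ltNge => h; rewrite (g0 x _).2// ltW// (le_lt_trans (ler_norm M))//.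
  by rewrite -[ltRHS]normrN (lt_le_trans _ (ler_norm _))// ltrNr.
rewrite (@ftc_halfline _ g dg _ M)//.
  by rewrite (g0 _ _).1 ?oppr0// normrN normr_id ler_norm.
by move=> x Mx; apply: g0; rewrite (le_trans Mx)// ler_norm.
Qed.

(** * Local integrability in the plane *)

(** * Local integrability *)

Definition loc_int (R : realType) (f : R * R -> R) :=
  forall L : R, (leb2 R).-integrable (square L) (EFin \o f).

Lemma measurable_square (R : realType) (L : R) :
  measurable (square L : set (measurableTypeR R * measurableTypeR R)).
Proof. by apply: measurableX; exact: measurable_itv. Qed.

Lemma loc_intD (R : realType) (f g : R * R -> R) :
  loc_int f -> loc_int g -> loc_int (f \+ g).
Proof.
move=> fi gi L.
exact: (integrableD (measurable_square L) (fi L) (gi L)).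
Qed.

Lemma loc_intZ (R : realType) (k : R) (f : R * R -> R) :
  loc_int f -> loc_int (fun x => k * f x).
Proof. move=> fi L. exact: (integrableZl (measurable_square L) k (fi L)). Qed.

Lemma loc_int_sum (R : realType) (n : nat) (f : 'I_n -> R * R -> R) :
  (forall i, loc_int (f i)) -> loc_int (fun x => \sum_(i < n) f i x).
Proof.
move=> fi L.
have := @integrable_sum _ _ _ _ _ (measurable_square L) _ (index_enum 'I_n) xpredT
  (fun i => EFin \o f i) (fun i _ => fi i L).
by apply: eq_integrable => [|x _] /=; [exact: measurable_square|rewrite sumEFin].
Qed.

Lemma leb2_rect (R : realType) (A B : set R) : measurable A -> measurable B ->
  (leb2 R (A `*` B) = @lebesgue_measure R A * @lebesgue_measure R B)%E.
Proof. move=> mA mB; exact: product_measure1E. Qed.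

Lemma loc_int_bounded (R : realType) (f : R * R -> R) (K : R) :
  measurable_fun [set: measurableTypeR R * measurableTypeR R] f ->
  (forall x, `|f x| <= K) -> loc_int f.
Proof.
move=> mf fK L; apply: measurable_bounded_integrable.
- exact: measurable_square.
- rewrite leb2_rect; [|exact: measurable_itv|exact: measurable_itv].
  rewrite lebesgue_measure_itv/=; case: ifPn => // _; last by rewrite mule0 ltry.
  by rewrite -EFinB -EFinM ltry.
- exact: measurable_funS mf.
- exists `|K|; split; first exact: num_real.
  move=> t Kt x _; exact: le_trans (fK x) (le_trans (ler_norm _) (ltW Kt)).
Qed.

Lemma loc_int_mul_integrable (R : realType) (M : R) (f g : R * R -> R) :
  loc_int f -> continuous g -> (forall x, ~ square M x -> g x = 0) ->
  (leb2 R).-integrable setT (EFin \o (f \* g)).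
Proof.
move=> fi cg g0.
have [K K0 gK] := bounded_off_square cg g0.
have mS := measurable_square M.
have : (leb2 R).-integrable (square M) (EFin \o (f \* g)).
  have := @integrableMl _ _ _ (leb2 R) _ mS _ g (fi M).
  apply.
    by apply: measurable_funS (continuous_measurable2 cg).
  exists K; split; first exact: num_real.
  move=> t Kt x _; exact: le_trans (gK x) (ltW Kt).
move/(integrable_mkcond _ mS); apply: eq_integrable => // x _.
rewrite patchE; case: ifPn => // /negP; rewrite inE => xM /=.
by rewrite (g0 x xM) mulr0.
Qed.

Lemma loc_int_indic (R : realType) (J : set (R * R)) :
  measurable (J : set (measurableTypeR R * measurableTypeR R)) ->
  loc_int (\1_J : R * R -> R).
Proof.
move=> mJ; apply: (@loc_int_bounded _ _ 1); first exact: measurable_indic.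
by move=> x; rewrite indicE; case: (_ \in _); rewrite ?normr1 ?normr0.
Qed.

Lemma loc_int_cst (R : realType) (k : R) : loc_int (cst k : R * R -> R).
Proof. by apply: (@loc_int_bounded _ _ `|k|) => //. Qed.

Lemma indic_halfplane (R : realType) (s : R) (x : R * R) :
  \1_(`[s, +oo[ `*` setT) x = (s <= x.1)%R%:R :> R.
Proof.
rewrite indicE; congr ((nat_of_bool _)%:R); apply/idP/idP.
  by move=> /set_mem[/=]; rewrite in_itv/= andbT.
by move=> h; apply: mem_set; split; rewrite //= in_itv/= h.
Qed.

Lemma measurable_halfplane (R : realType) (s : R) :
  measurable (`[s, +oo[ `*` setT :
    set (measurableTypeR R * measurableTypeR R)).
Proof. by apply: measurableX => //; exact: measurable_itv. Qed.

(** * Pairing of a row with a test function *)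

Lemma fubini_yx (R : realType) (F : R * R -> R) (G : R -> R) :
  (leb2 R).-integrable setT (EFin \o F) ->
  (forall y, \int[@lebesgue_measure R]_x (F (x, y))%:E = (G y)%:E)%E ->
  Rintegral (leb2 R) setT F = Rintegral (@lebesgue_measure R) setT G.
Proof.
move=> iF FG; rewrite /Rintegral; congr fine.
rewrite -[LHS](integral21_prod_meas1 iF).
by apply: eq_integral => y _; exact: FG.
Qed.

Lemma fubini_xy (R : realType) (F : R * R -> R) (G : R -> R) :
  (leb2 R).-integrable setT (EFin \o F) ->
  (forall x, \int[@lebesgue_measure R]_y (F (x, y))%:E = (G x)%:E)%E ->
  Rintegral (leb2 R) setT F = Rintegral (@lebesgue_measure R) setT G.
Proof.
move=> iF FG; rewrite /Rintegral; congr fine.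
rewrite -[LHS](integral12_prod_meas1 iF).
by apply: eq_integral => y _; exact: FG.
Qed.

(** The distributional curl [- d_2 a + d_1 b] of the row [(a, b)], tested on the
    function with partial derivatives [d1] and [d2]. *)
Definition pairing (R : realType) (a b d1 d2 : R * R -> R) : R :=
  Rintegral (leb2 R) setT (fun x => a x * d2 x - b x * d1 x).

Section pairing_theory.
Context (R : realType) (M : R) (f d1 d2 : R * R -> R).
Hypothesis F : C1c M f d1 d2.
Implicit Types a b : R * R -> R.

Let i1 a : loc_int a -> (leb2 R).-integrable setT (EFin \o (a \* d1)).
Proof.
move=> ia; apply: loc_int_mul_integrable ia (C1c_cont1 F) _ => x.
by move/(C1c_off F) => [].
Qed.

Let i2 a : loc_int a -> (leb2 R).-integrable setT (EFin \o (a \* d2)).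
Proof.
move=> ia; apply: loc_int_mul_integrable ia (C1c_cont2 F) _ => x.
by move/(C1c_off F) => [].
Qed.

Lemma pairing_integrable a b : loc_int a -> loc_int b ->
  (leb2 R).-integrable setT (EFin \o (fun x => a x * d2 x - b x * d1 x)).
Proof. by move=> /i2 ia /i1 ib; exact: (integrableB measurableT ia ib). Qed.

Lemma pairingD a b a' b' : loc_int a -> loc_int b -> loc_int a' -> loc_int b' ->
  pairing (a \+ a') (b \+ b') d1 d2 = pairing a b d1 d2 + pairing a' b' d1 d2.
Proof.
move=> ia ib ia' ib'; rewrite /pairing -RintegralD//; try exact: pairing_integrable.
by apply: eq_Rintegral => x _ /=; ring.
Qed.

Lemma pairingZ (k : R) a b : loc_int a -> loc_int b ->
  pairing (fun x => k * a x) (fun x => k * b x) d1 d2 = k * pairing a b d1 d2.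
Proof.
move=> ia ib; rewrite /pairing -RintegralZl//; last exact: pairing_integrable.
by apply: eq_Rintegral => x _ /=; ring.
Qed.

Lemma pairing_sum n (a b : 'I_n -> R * R -> R) :
  (forall i, loc_int (a i)) -> (forall i, loc_int (b i)) ->
  pairing (fun x => \sum_(i < n) a i x) (fun x => \sum_(i < n) b i x) d1 d2 =
  \sum_(i < n) pairing (a i) (b i) d1 d2.
Proof.
elim: n a b => [|n IH] a b ia ib.
  rewrite big_ord0 /pairing (_ : (fun _ => _) = cst 0).
    by rewrite Rintegral_cst// mul0r.
  by apply/funext => x; rewrite !big_ord0 !mul0r subr0.
rewrite big_ord_recr/= -IH//.
rewrite -pairingD//; try exact: loc_int_sum.
by congr pairing; apply/funext => x; rewrite big_ord_recr.
Qed.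

(** On each horizontal line [d1] integrates to [- f (s, y)] over [x.1 >= s]: the row
    [(0, 1)] on the right of [x.1 = s] has its curl spread over that line. *)
Lemma pairing_strip (s : R) (J : set R) : measurable J ->
  pairing (cst 0) \1_(`[s, +oo[ `*` J) d1 d2 =
  Rintegral (@lebesgue_measure R) J (fun y => f (s, y)).
Proof.
move=> mJ; rewrite Rintegral_mkcond /pairing.
apply: fubini_yx.
  apply: pairing_integrable.
    exact: loc_int_cst.
  by apply: loc_int_indic; apply: measurableX.
move=> y.
have [yJ|yJ] := boolP (y \in J); rewrite patchE ?yJ ?(negbTE yJ); last first.
  rewrite (_ : (fun _ => _) = cst 0%E) ?integral0//; apply/funext => r /=.
  rewrite indicE (_ : _ \in _ = false) ?mul0r ?subr0 ?mulr0//.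
  by apply/negbTE; apply: contra yJ => /set_mem[_ /= ?]; rewrite inE.
transitivity (\int[@lebesgue_measure R]_(r in `[s, +oo[) (- d1 (r, y))%:E)%E.
  apply: eq_integral_ext0 => // r.
  - move=> _ /= sr; rewrite indicE mem_set ?mul1r ?mul0r ?sub0r//.
    by split => //=; exact: set_mem.
  - move=> _ /= sr; rewrite indicE memNset ?mul0r ?subr0//.
    by case.
  - by move/(_ I).
rewrite [LHS](@ftc_halfline R (fun r => - f (r, y)) (fun r => - d1 (r, y)) s M).
- by rewrite opprK.
- move=> x; apply: is_deriveN; exact: C1c_der1 F x y.
- by move=> x; apply: cvgN; exact: (continuous_slice1 y (C1c_cont1 F)).
- move=> x Mx; have [] := C1c_off F (x := (x, y)).
    by move=> [/=]; rewrite in_itv/= => /andP[_]; rewrite ltNge Mx.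
  by move=> -> -> _; rewrite oppr0.
Qed.

(** A jump of the first entry across a vertical line is invisible to the curl. *)
Lemma pairing_cst_halfplane (s : R) : pairing \1_(`[s, +oo[ `*` setT) (cst 0) d1 d2 = 0.
Proof.
rewrite /pairing (@fubini_xy _ _ (cst 0)).
- by rewrite Rintegral_cst// mul0r.
- apply: pairing_integrable.
    by apply: loc_int_indic; exact: measurable_halfplane.
  exact: loc_int_cst.
move=> r; have [sr|sr] := boolP (s <= r).
  rewrite -[RHS](@ftc_line _ (fun y => f (r, y)) (fun y => d2 (r, y)) M)//.
  - by apply: eq_integral => y _; rewrite indic_halfplane/= sr mul1r mul0r subr0.
  - move=> y; exact: C1c_der2 F r y.
  - exact: (continuous_slice2 _ (C1c_cont2 F)).
  - move=> y My; have [] := C1c_off F (x := (r, y)); last by [].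
    by move=> [_ /=]; rewrite in_itv/= -ltr_norml ltNge My.
rewrite (_ : (fun _ => _) = cst 0%E) ?integral0//; apply/funext => y /=.
by rewrite indic_halfplane/= (negbTE sr) !mul0r subr0.
Qed.

Lemma pairing_eq_square a b a' b' :
  (forall x, square M x -> a x = a' x /\ b x = b' x) ->
  pairing a b d1 d2 = pairing a' b' d1 d2.
Proof.
move=> e; apply: eq_Rintegral => x _.
have [xM|xM] := pselect (square M x); first by have [-> ->] := e x xM.
by have [_ -> ->] := C1c_off F xM; rewrite !mulr0.
Qed.

(** On the support of [f], a constant is an indicator of a half-plane whose boundary
    line the support does not meet. *)
Lemma pairing_cst (k l : R) : pairing (cst k) (cst l) d1 d2 = 0.
Proof.
pose H : R * R -> R := \1_(`[(- `|M|), +oo[ `*` setT).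
have l0 : loc_int (cst 0 : R * R -> R) by exact: loc_int_cst.
have iH : loc_int H by apply: loc_int_indic; exact: measurable_halfplane.
rewrite (@pairing_eq_square _ _ ((fun x => k * H x) \+ (fun x => l * cst 0 x))
   ((fun x => k * cst 0 x) \+ (fun x => l * H x))); last first.
  move=> x [xM _] /=; rewrite /H indicE mem_set ?mulr0 ?mulr1 ?addr0 ?add0r//.
  split => //; move: xM; rewrite /= !in_itv/= andbT => /andP[Mx xM].
  by rewrite (le_trans _ (ltW Mx))// lerN2 ler_norm.
rewrite pairingD; try exact: loc_intZ.
rewrite !pairingZ// pairing_cst_halfplane pairing_strip//.
rewrite mulr0 add0r (_ : (fun _ => _) = cst 0) ?Rintegral_cst ?mul0r ?mulr0//.
apply/funext => y; have [] := C1c_off F (x := ((- `|M|), y)); last by [].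
move=> [/=]; rewrite in_itv/= => /andP[+ _]; rewrite ltNge lerN2.
by rewrite ler_norm.
Qed.

End pairing_theory.

(** * The field of one dislocation *)

Lemma measurable_invr (R : realType) : measurable_fun [set: R] (fun r : R => r^-1).
Proof.
rewrite (_ : [set: R] = [set 0] `|` ~` [set 0]); last by rewrite setUv.
apply/measurable_funU => //; first exact: measurableC.
split; first exact: measurable_fun_set1.
apply: open_continuous_measurable_fun.
  by apply: closed_openC; rewrite -set_itv1; exact: interval_closed.
move=> x; rewrite inE /= => /eqP x0; exact: inv_continuous.
Qed.

Section cone.
Context (R : realType) (w c : R).
Hypothesis w0 : 0 < w.

Definition cone : set (R * R) := [set x | 0 < x.1 < w /\ `|x.2 - c| <= x.1].

(** [(cone_a, cone_b)] is the gradient of [w * (x.2 - c) / x.1], a function that is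
    constant on each ray from the apex [(0, c)]. *)
Definition cone_a (x : R * R) : R := \1_cone x * (- w * (x.2 - c) / x.1 ^+ 2).
Definition cone_b (x : R * R) : R := \1_cone x * (w / x.1).

Let P := (measurableTypeR R * measurableTypeR R)%type.

Lemma measurable_cone : measurable (cone : set P).
Proof.
rewrite (_ : cone = (setT `&` fst @^-1` `]0, w[) `&`
   (setT `&` (fun x : P => x.1 - `|x.2 - c|) @^-1` `[0, +oo[)).
  apply: measurableI.
    by apply: measurable_fst => //; exact: measurable_itv.
  apply: (continuous_measurable2 (f := fun x => x.1 - `|x.2 - c|)) => //.
  move=> x; apply: (@cvgB R R _ (nbhs x) _ fst (fun x => `|x.2 - c|)).
    exact: cvg_fst.
  apply: (@cvg_norm R R _ (nbhs x) _ (fun x => x.2 - c)).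
  apply: (@cvgB R R _ (nbhs x) _ snd (cst c)); [exact: cvg_snd|exact: cvg_cst].
apply/seteqP; split => x; rewrite /cone/= !in_itv/= andbT subr_ge0.
  by move=> [-> ->].
by move=> [[_ ->] [_ ->]].
Qed.

Lemma measurable_cone_b : measurable_fun [set: P] cone_b.
Proof.
apply: measurable_funM; first by apply: measurable_indic; exact: measurable_cone.
apply: measurable_funM => //.
by apply: (measurableT_comp (@measurable_invr R)); exact: measurable_fst.
Qed.

Lemma measurable_cone_a : measurable_fun [set: P] cone_a.
Proof.
apply: measurable_funM; first by apply: measurable_indic; exact: measurable_cone.
apply: measurable_funM.
  apply: measurable_funM => //; apply: measurable_funB => //; exact: measurable_snd.
apply: (measurableT_comp (@measurable_invr R)).
by apply: measurable_funX; exact: measurable_fst.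
Qed.

Lemma cone_a_le x : `|cone_a x| <= `|cone_b x|.
Proof.
rewrite /cone_a /cone_b indicE; have [/set_mem xK|_] := boolP (x \in cone);
  last by rewrite !mul0r.
case: xK => /andP[x0 _] xc.
rewrite !mul1r !normrM normrN !normfV normrX (gtr0_norm x0).
have -> : `|w| * `|x.2 - c| / x.1 ^+ 2 = `|w| / x.1 * (`|x.2 - c| / x.1).
  by field; rewrite gt_eqF.
apply: ler_piMr; first by rewrite divr_ge0// ltW.
by rewrite ler_pdivrMr// mul1r.
Qed.

(** A slice of length [2 * r] of a field of size [w / r]: the same total on each
    slice, hence an integrable singularity at the apex. *)
Lemma integral_cone_b_slice r :
  (\int[@lebesgue_measure R]_y `|(cone_b (r, y))%:E| =
   (2 * w * \1_`]0, w[ r)%:E)%E.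
Proof.
have [/set_mem/=|/negP] := boolP (r \in `]0, w[%classic); last first.
  rewrite inE => rw; rewrite indicE memNset// mulr0.
  rewrite (_ : (fun _ => _) = cst 0%E) ?integral0//; apply/funext => y /=.
  rewrite /cone_b indicE memNset ?mul0r ?normr0//; move=> [] /=.
  by move=> ? _; apply: rw; rewrite /= in_itv.
rewrite in_itv/= => /andP[r0 rw].
rewrite indicE mem_set/= ?in_itv/= ?r0 ?rw// mulr1.
transitivity (\int[@lebesgue_measure R]_(y in `[(c - r)%R, (c + r)%R]) (w / r)%:E)%E.
  have e y : (y \in `[c - r, c + r]) = (`|y - c| <= r).
    by rewrite in_itv/= ler_distl.
  apply: eq_integral_ext0 => // y.
  - move=> _ /=; rewrite e => yr; rewrite /cone_b indicE mem_set ?mul1r.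
      by rewrite ger0_norm// divr_ge0// ltW.
    by split; rewrite /= ?r0.
  - move=> _ /=; rewrite e => yr; rewrite /cone_b indicE memNset ?mul0r ?normr0//.
    by case.
  - by move/(_ I).
rewrite integral_cst/=; last exact: measurable_itv.
rewrite lebesgue_measure_itv/= lte_fin ifT; last by lra.
by rewrite -EFinB -EFinM; congr EFin; field; rewrite gt_eqF.
Qed.

Lemma loc_int_cone_b : loc_int cone_b.
Proof.
move=> L; apply: (@integrableS _ _ _ _ setT) => //; first exact: measurable_square.
have mc : measurable_fun [set: P] (EFin \o cone_b).
  by apply/measurable_EFinP; exact: measurable_cone_b.
apply: (@integrable12ltyP _ _ _ _ R (@lebesgue_measure R) (@lebesgue_measure R) _ mc).2.
rewrite [ltLHS](_ : _ = \int[@lebesgue_measure R]_r (2 * w * \1_`]0, w[ r)%:E)%E; last first.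
  by apply: eq_integral => r _; exact: integral_cone_b_slice.
under eq_integral do rewrite EFinM.
rewrite ge0_integralZl//.
rewrite integral_indic//= setIT lebesgue_measure_itv/= lte_fin w0.
  by rewrite -EFinB -EFinM ltry.
- by apply/measurable_EFinP; apply: measurable_indic.
- by rewrite lee_fin mulr_ge0// ltW.
Qed.

Lemma loc_int_cone_a : loc_int cone_a.
Proof.
move=> L; apply: le_integrable (loc_int_cone_b L).
- exact: measurable_square.
- apply/measurable_EFinP; apply: measurable_funS measurable_cone_a => //.
- by move=> x _; rewrite lee_fin; exact: cone_a_le.
Qed.

End cone.

Section cone_pairing.
Context (R : realType) (M : R) (f d1 d2 : R * R -> R).
Hypothesis F : C1c M f d1 d2.
Variables (w c : R).
Hypothesis w0 : 0 < w.

(** The derivative in [r] of [f] along the ray from the apex [(0, c)] to [(w, z)]. *)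
Let K (r z : R) : R :=
  d1 (r, c + (z - c) / w * r) + (z - c) / w * d2 (r, c + (z - c) / w * r).

Let contK : continuous (fun x : R * R => K x.1 x.2).
Proof.
have cv : continuous (fun x : R * R => (x.2 - c) / w).
  move=> x; apply: (@cvgM R _ (nbhs x) _ (fun x => x.2 - c) (cst w^-1));
    last exact: cvg_cst.
  apply: (@cvgB R R _ (nbhs x) _ snd (cst c)); [exact: cvg_snd|exact: cvg_cst].
have cr : continuous (fun x : R * R => c + (x.2 - c) / w * x.1).
  move=> x; apply: (@cvgD R R _ (nbhs x) _ (cst c) (fun x => (x.2 - c) / w * x.1));
    first exact: cvg_cst.
  apply: (@cvgM R _ (nbhs x) _ (fun x => (x.2 - c) / w) fst); [exact: cv|exact: cvg_fst].
have cf : continuous (fst : R * R -> R) by move=> x; exact: cvg_fst.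
move=> x; apply: (@cvgD R R _ (nbhs x) _ (fun x => d1 (x.1, c + (x.2 - c) / w * x.1))
  (fun x => (x.2 - c) / w * d2 (x.1, c + (x.2 - c) / w * x.1))).
  exact: (continuous_comp2 (C1c_cont1 F) cf cr).
apply: (@cvgM R _ (nbhs x) _ (fun x => (x.2 - c) / w)
  (fun x => d2 (x.1, c + (x.2 - c) / w * x.1))); first exact: cv.
exact: (continuous_comp2 (C1c_cont2 F) cf cr).
Qed.

Let contK1 z : continuous (fun r => K r z).
Proof. exact: (continuous_slice1 z contK). Qed.

Let contK2 r : continuous (fun z => K r z).
Proof. exact: (continuous_slice2 r contK). Qed.

Let I : set R := `[c - w, c + w].

Let H (x : R * R) : R := \1_(`]0, w[ `*` I) x * - K x.1 x.2.

Let mI : measurable I. Proof. exact: measurable_itv. Qed.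

Let intH : (leb2 R).-integrable setT (EFin \o H).
Proof.
pose D : set (R * R) := `]0, w[ `*` I.
have mD : measurable (D : set (measurableTypeR R * measurableTypeR R)).
  by apply: measurableX; exact: measurable_itv.
have cNK : continuous (fun x : R * R => - K x.1 x.2).
  by move=> x; apply: cvgN; exact: contK.
have : (leb2 R).-integrable D (EFin \o (fun x : R * R => - K x.1 x.2)).
  apply: measurable_bounded_integrable => //.
  - rewrite leb2_rect; [|exact: measurable_itv|exact: measurable_itv].
    rewrite !lebesgue_measure_itv/= !lte_fin w0; case: ifP => _.
      by rewrite -!EFinB -EFinM ltry.
    by rewrite mule0 ltry.
  - exact: measurable_funS (continuous_measurable2 cNK).
  have cpt : compact (`[0, w] `*` `[c - w, c + w] : set (R * R)).
    by apply: compact_setX; exact: segment_compact.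
  have /compact_bounded[B [Br hB]] :
      compact ((fun x : R * R => - K x.1 x.2) @` (`[0, w] `*` `[c - w, c + w])).
    by apply: continuous_compact => //; exact: continuous_subspaceT.
  exists B; split => // t Bt x [x1 x2]; apply: (hB t Bt); exists x => //.
  by split => //; exact: subset_itv_oo_cc x1.
move/(integrable_mkcond _ mD); apply: eq_integrable => // x _.
rewrite patchE; case: ifPn => xD /=; rewrite /H indicE -/D.
  by rewrite xD mul1r.
by rewrite (negbTE xD) mul0r.
Qed.

Let continuous_segment_fin (g : R -> R) : continuous g ->
  (\int[@lebesgue_measure R]_(z in I) (g z)%:E =
   (Rintegral (@lebesgue_measure R) I g)%:E)%E.
Proof.
move=> cg; rewrite /Rintegral fineK//; apply: integrable_fin_num => //.
apply: continuous_compact_integrable; first exact: segment_compact.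
exact: continuous_subspaceT.
Qed.

(** On the slice at [r], the substitution sends the end point [z] of a ray to its height
    [c + (z - c) / w * r]; the Jacobian [r / w] cancels the size [w / r] of the
    field, and the slope of the ray is the ratio of the two entries. *)
Let slice r : 0 < r < w ->
  (\int[@lebesgue_measure R]_y
     (cone_a w c (r, y) * d2 (r, y) - cone_b w c (r, y) * d1 (r, y))%:E =
   \int[@lebesgue_measure R]_(z in I) (- K r z)%:E)%E.
Proof.
move=> /andP[r0 rw].
pose g y := - (w / r) * (d1 (r, y) + (y - c) / r * d2 (r, y)).
pose S z := c + (z - c) / w * r.
transitivity (\int[@lebesgue_measure R]_(y in `[(c - r)%R, (c + r)%R]) (g y)%:E)%E.
  have e y : (y \in `[c - r, c + r]) = (`|y - c| <= r).
    by rewrite in_itv/= ler_distl.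
  apply: eq_integral_ext0 => // y.
  - move=> _ /=; rewrite e => yr; rewrite /cone_b /cone_a indicE mem_set.
      by rewrite /g/=; congr EFin; field; rewrite gt_eqF.
    by split; rewrite /= ?r0.
  - move=> _ /=; rewrite e => yr; rewrite /cone_b /cone_a indicE memNset.
      by rewrite !mul0r subr0.
    by case.
  - by move/(_ Logic.I).
have Sa : S (c - w) = c - r by rewrite /S; field; rewrite gt_eqF.
have Sb : S (c + w) = c + r by rewrite /S; field; rewrite gt_eqF.
have dS z : is_derive z (1 : R) S (r / w).
  have -> : S = cst (c - c / w * r) + (r / w) \*: (@id R).
    apply/funext => x; rewrite /S -[RHS]/(c - c / w * r + r / w * x).
    by field; rewrite gt_eqF.
  by apply: is_derive_eq; rewrite add0r /GRing.scale/= mulr1.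
have S' : derive1 S = cst (r / w).
  by apply/funext => z; rewrite derive1E; case: (dS z).
have contg : continuous g.
  move=> y; apply: cvgM; first exact: cvg_cst.
  apply: cvgD; first exact: (continuous_slice2 r (C1c_cont1 F)).
  apply: cvgM; last exact: (continuous_slice2 r (C1c_cont2 F)).
  by apply: cvgM; [apply: cvgB; [exact: cvg_id|exact: cvg_cst]|exact: cvg_cst].
have contS : continuous S.
  move=> z; apply: differentiable_continuous; apply/derivable1_diffP.
  by case: (dS z).
rewrite -Sa -Sb integration_by_substitution_increasing.
- apply: eq_integral => z _; rewrite S'; congr EFin.
  rewrite -[LHS]/(g (S z) * (r / w)) /g /K.
  have -> : (S z - c) / r = (z - c) / w by rewrite /S; field; rewrite !gt_eqF.
  by rewrite -/(S z); field; rewrite !gt_eqF.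
- lra.
- move=> x y _ _ xy; rewrite /S ltrD2l ltr_pM2r// ltr_pM2r ?invr_gt0// ltrD2r//.
- by rewrite S' => z _; exact: cvg_cst.
- by rewrite S'; exact: is_cvg_cst.
- by rewrite S'; exact: is_cvg_cst.
- split.
  + by move=> z _; case: (dS z).
  + exact: cvg_at_right_filter (contS _).
  + exact: cvg_at_left_filter (contS _).
- exact: continuous_subspaceT.
Qed.

(** After the substitution on every slice the order of integration is exchanged, and
    each ray contributes the difference of [f] between its two end points. *)
Lemma pairing_cone : pairing (cone_a w c) (cone_b w c) d1 d2 =
  2 * w * f (0, c) - Rintegral (@lebesgue_measure R) I (fun z => f (w, z)).
Proof.
pose G r := if 0 < r < w then
  Rintegral (@lebesgue_measure R) I (fun z => - K r z) else 0.
have cNK r : continuous (fun z => - K r z).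
  by move=> z; apply: cvgN; exact: contK2.
have pG : pairing (cone_a w c) (cone_b w c) d1 d2 =
    Rintegral (@lebesgue_measure R) setT G.
  apply: fubini_xy.
    by apply: (pairing_integrable F); [exact: loc_int_cone_a|exact: loc_int_cone_b].
  move=> r; rewrite /G; case: ifPn => rw.
    by rewrite slice// continuous_segment_fin.
  rewrite (_ : (fun _ => _) = cst 0%E) ?integral0//; apply/funext => y /=.
  by rewrite /cone_a /cone_b indicE memNset ?mul0r ?subr0//; case=> /= /(negP rw).
have HG : Rintegral (leb2 R) setT H = Rintegral (@lebesgue_measure R) setT G.
  apply: fubini_xy => // r; rewrite /G; case: ifPn => rw.
    rewrite -continuous_segment_fin//; apply: eq_integral_ext0 => // z.
    - by move=> _ zI; rewrite /H indicE mem_set ?mul1r//; split; rewrite //= in_itv.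
    - by move=> _ zI; rewrite /H indicE memNset ?mul0r//; case.
    - by move/(_ Logic.I).
  rewrite (_ : (fun _ => _) = cst 0%E) ?integral0//; apply/funext => y /=.
  rewrite /H indicE memNset ?mul0r ?subr0//; case=> /=.
  by rewrite in_itv/= (negbTE rw).
rewrite pG -HG.
pose G2 := (fun z => f (0, c) - f (w, z)) \_ I.
have cfw : continuous (fun z => f (w, z)).
  exact: (continuous_slice2 _ (C1c_cont F)).
rewrite (@fubini_yx _ _ G2)//; last first.
  move=> z; rewrite /G2 patchE; case: ifPn => zI; last first.
    rewrite (_ : (fun _ => _) = cst 0%E) ?integral0//; apply/funext => y /=.
    rewrite /H indicE memNset ?mul0r ?subr0//; case=> /= _.
    by move=> h; move: zI; rewrite mem_set.
  move/set_mem in zI.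
  transitivity (\int[@lebesgue_measure R]_(r in `]0%R, w[) (- K r z)%:E)%E.
    apply: eq_integral_ext0 => // r.
    - by move=> _ zr; rewrite /H indicE mem_set ?mul1r.
    - by move=> _ zr; rewrite /H indicE memNset ?mul0r//; case.
    - by move/(_ Logic.I).
  have cN : continuous (fun r => - K r z).
    by move=> r; apply: cvgN; exact: contK1.
  rewrite -(@integral_itv_bndoo _ _ _ _ true false); last first.
    apply/measurable_EFinP; apply: measurable_funS (continuous_measurable_fun cN) => //.
  rewrite [LHS](@ftc_segment R (fun s => - f (s, c + (z - c) / w * s))
    (fun r => - K r z) 0 w)//; last 2 first.
  - exact: ltW.
  - by move=> s; apply: is_deriveN; exact: is_derive_ray F.
  congr EFin; rewrite mulr0 addr0 opprK addrC; congr (_ - f (_, _)).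
  by rewrite divfK ?gt_eqF// addrC subrK.
rewrite /G2 -Rintegral_mkcond RintegralB//; last 2 first.
- apply: continuous_compact_integrable; first exact: segment_compact.
  by apply: continuous_subspaceT => z; exact: cvg_cst.
- apply: continuous_compact_integrable; first exact: segment_compact.
  exact: continuous_subspaceT.
congr (_ - _); rewrite Rintegral_cst//= lebesgue_measure_itv/= lte_fin.
rewrite ifT; last by move: w0 => w0'; lra.
by rewrite mulrC; congr (_ * _); rewrite -EFinB /=; ring.
Qed.
End cone_pairing.

(** * Cells along the line of dislocations *)

Section cell.
Context (R : realType) (w : R).
Hypothesis w0 : 0 < w.

Definition cell_b (c : R) (x : R * R) : R :=
  cone_b w c x + \1_(`[w, +oo[ `*` `[c - w, c + w[) x.

Lemma loc_int_cell_b c : loc_int (cell_b c).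
Proof.
apply: loc_intD; first exact: loc_int_cone_b.
by apply: loc_int_indic; apply: measurableX; exact: measurable_itv.
Qed.

(** The flux of the cone through [x.1 = w] is that of the constant part: only the
    charge at the apex remains. *)
Lemma pairing_cell (M : R) (f d1 d2 : R * R -> R) (c : R) : C1c M f d1 d2 ->
  pairing (cone_a w c) (cell_b c) d1 d2 = 2 * w * f (0, c).
Proof.
move=> F.
rewrite (_ : cone_a w c = cone_a w c \+ cst 0); last first.
  by apply/funext => x /=; rewrite addr0.
rewrite (pairingD F); last 4 first.
- exact: loc_int_cone_a.
- exact: loc_int_cone_b.
- exact: loc_int_cst.
- by apply: loc_int_indic; apply: measurableX; exact: measurable_itv.
rewrite (pairing_cone F)// (pairing_strip F); last exact: measurable_itv.
rewrite Rintegral_itv_bndo_bndc ?subrK//.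
apply: (@integrableS _ _ _ (@lebesgue_measure R) `[c - w, c + w]%classic) => //.
  by move=> z /=; exact: subset_itv_co_cc.
apply: continuous_compact_integrable; first exact: segment_compact.
apply: continuous_subspaceT.
exact: (continuous_slice2 _ (C1c_cont F)).
Qed.

(** The centre of the cell of height [y], for the half-open cells
    [[c - w, c + w[] with [c] a multiple of [2 * w]. *)
Definition ctr (y : R) : R := 2 * w * (Num.floor (y / (2 * w) + 2^-1))%:~R.

Lemma ctrP y : - w <= y - ctr y < w.
Proof.
have w2 : 0 < 2 * w by rewrite mulr_gt0.
have := floor_itv (y / (2 * w) + 2^-1); rewrite -/(Num.floor _).
set k := Num.floor _ => /andP[k1 k2].
have e : y = 2 * w * (y / (2 * w)) by rewrite mulrC divfK// gt_eqF.
move: k1 k2; rewrite intrD => k1 k2.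
rewrite /ctr -/k; move: w0 => w0'; apply/andP; split; rewrite [X in X - _]e; nra.
Qed.

Definition ctrs (N : nat) (i : 'I_(2 * N).+1) : R := 2 * w * (i%:R - N%:R).

Lemma ctr_in_ctrs (N : nat) (y : R) :
  - ((2 * N).+1%:R * w) <= y < (2 * N).+1%:R * w ->
  exists j : 'I_(2 * N).+1, ctrs j = ctr y.
Proof.
have w0' := w0; move=> /andP[yl yu].
have /andP[h1 h2] := ctrP y.
set k := Num.floor (y / (2 * w) + 2^-1).
have ck : ctr y = 2 * w * k%:~R by [].
move: yl yu; rewrite -natr1 natrM => yl yu.
have kl : - (N%:Z) <= k.
  rewrite -ltzD1 -(ltr_int R) rmorphN rmorphD/=.
  rewrite ck in h1 h2; nra.
have ku : k <= N%:Z.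
  rewrite -ltzD1 -(ltr_int R) rmorphD/=.
  rewrite ck in h1 h2; nra.
have jlt : (`|(k + N%:Z)%R|%N < (2 * N).+1)%N by lia.
exists (Ordinal jlt); rewrite /ctrs ck /=; congr (_ * _).
have -> : ((`|(k + N%:Z)%R|%N)%:R : R) = (k + N%:Z)%:~R.
  by rewrite -[LHS]/((Posz `|(k + N%:Z)%R|%N)%:~R) gez0_abs//; lia.
by rewrite rmorphD/=; ring.
Qed.

(** A finite sum of contributions supported in single cells is the contribution of
    the cell of [y]; it turns the sums used for pairings into pointwise formulas. *)
Lemma sum_ctrs (N : nat) (y : R) (phi : R -> R) :
  (forall c, ~~ (- w <= y - c < w) -> phi c = 0) ->
  \sum_(i < (2 * N).+1) phi (ctrs i) =
  if - ((2 * N).+1%:R * w) <= y < (2 * N).+1%:R * w then phi (ctr y) else 0.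
Proof.
move=> phi0; have w0' := w0.
case: ifPn => [/andP[yl yu]|yN]; last first.
  apply: big1 => i _; apply: phi0; apply: contra yN => /andP[h1 h2].
  have : (i%:R : R) <= (2 * N)%:R by rewrite ler_nat -ltnS.
  have : (0 : R) <= i%:R by rewrite ler0n.
  move: h1 h2; rewrite /ctrs -natr1 natrM => h1 h2 i0 iN.
  by apply/andP; split; nra.
have /andP[h1 h2] := ctrP y.
have [j ej] := ctr_in_ctrs (introT andP (conj yl yu)).
rewrite (bigD1 j)//= ej big1 ?addr0// => i ij.
apply: phi0; apply/negP => /andP[i1 i2]; move/eqP: ij; apply; apply/val_inj/eqP => /=.
move: ej i1 i2 h1 h2; rewrite /ctrs => <- i1 i2 h1 h2.
rewrite eqn_leq; apply/andP; split; rewrite -ltnS -(ltr_nat R) -natr1; nra.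
Qed.
End cell.

(** * Energy of one cone *)

Lemma integral_invr (R : realType) (a b : R) : 0 < a -> a <= b ->
  (\int[@lebesgue_measure R]_(r in `[a, b]) (r^-1)%:E = (ln b - ln a)%:E)%E.
Proof.
move=> a0; rewrite le_eqVlt => /predU1P[<-|ab].
  by rewrite set_itv1 integral_set1 subrr.
have p x : x \in `[a, b] -> 0 < x.
  by rewrite in_itv/= => /andP[ax _]; exact: lt_le_trans ax.
rewrite (@continuous_FTC2 _ (fun r => r^-1) (@ln R))//.
- apply: continuous_in_subspaceT => x /set_mem /= /p x0.
  by apply: inv_continuous; rewrite gt_eqF.
- split.
  + move=> x /subset_itv_oo_cc /p x0; by case: (is_derive1_ln x0).
  + apply: cvg_at_right_filter; exact: continuous_ln.
  + apply: cvg_at_left_filter; apply: continuous_ln; exact: lt_trans ab.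
- move=> x /subset_itv_oo_cc /p x0; rewrite derive1E; by case: (is_derive1_ln x0).
Qed.

Section cone_energy_integral.
Context (R : realType) (w rho : R).
Hypotheses (w0 : 0 < w) (rho0 : 0 < rho).

(** The apex is cut off at [rho / 2]: a point of the cone at distance at least [rho]
    from the apex has first coordinate at least [rho / 2]. *)
Definition cone_energy (c : R) (x : R * R) : R :=
  \1_(`[rho / 2, +oo[ `*` setT) x * cone_b w c x ^+ 2.

Let mu := @lebesgue_measure R.

Lemma cone_b_ge0 (c : R) x : 0 <= cone_b w c x.
Proof.
rewrite /cone_b indicE; have [/set_mem[/andP[x0 _] _]|_] := boolP (_ \in _).
  by rewrite mul1r divr_ge0// ltW.
by rewrite mul0r.
Qed.

Lemma cone_energy_ge0 c x : 0 <= cone_energy c x.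
Proof. by rewrite /cone_energy indicE mulr_ge0 ?ler0n// sqr_ge0. Qed.

Lemma measurable_cone_energy c :
  measurable_fun [set: measurableTypeR R * measurableTypeR R] (cone_energy c).
Proof.
apply: measurable_funM.
  by apply: measurable_indic; apply: measurableX => //; exact: measurable_itv.
by apply: measurable_funX; exact: measurable_cone_b.
Qed.

(** Slices of length [2 * r] of a density [(w / r) ^ 2] integrate to the logarithm. *)
Lemma integral_cone_energy c :
  (\int[leb2 R]_x (cone_energy c x)%:E <= (2 * w ^+ 2 * `|ln (2 * w / rho)|)%:E)%E.
Proof.
have w0' := w0. have rho0' := rho0.
have E1 : (\int[leb2 R]_x (cone_energy c x)%:E =
    \int[mu]_r \int[mu]_y (cone_energy c (r, y))%:E)%E.
  apply: (@fubini_tonelli1 _ _ _ _ R mu mu (EFin \o cone_energy c)).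
    by apply/measurable_EFinP; exact: measurable_cone_energy.
  by move=> x; rewrite lee_fin cone_energy_ge0.
rewrite E1.
have E2 r : (\int[mu]_y (cone_energy c (r, y))%:E =
    (2 * w ^+ 2)%:E * (r^-1 * \1_`[rho / 2, w[ r)%:E)%E.
  have [h|h] := boolP (rho / 2 <= r); last first.
    rewrite [in RHS]indicE memNset ?mulr0 ?mule0; last first.
      by rewrite /= in_itv/= (negbTE h).
    rewrite (_ : (fun _ => _) = cst 0%E) ?integral0//; apply/funext => y /=.
    rewrite /cone_energy indicE memNset ?mul0r//; case=> /=.
    by rewrite in_itv/= andbT (negbTE h).
  have r0 : 0 < r by lra.
  transitivity (\int[mu]_y ((w / r)%:E * `|(cone_b w c (r, y))%:E|))%E.
    apply: eq_integral => y _; rewrite /cone_energy indicE mem_set ?mul1r; last first.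
      by split => //=; rewrite in_itv/= h.
    rewrite /= ger0_norm ?cone_b_ge0// -EFinM; congr EFin.
    rewrite /cone_b indicE; case: (_ \in _); rewrite ?mul0r ?mul1r ?expr0n ?mulr0//=.
  rewrite ge0_integralZl//; last first.
  - by rewrite lee_fin divr_ge0// ltW.
  - apply: measurableT_comp => //; apply/measurable_EFinP.
    apply: (measurableT_comp (measurable_cone_b w c)); exact: pair1_measurable.
  rewrite integral_cone_b_slice// !indicE -!EFinM; congr EFin.
  have -> : (r \in `]0, w[%classic) = (r \in `[rho / 2, w[%classic).
    by apply/idP/idP => /set_mem/=; rewrite in_itv/= => /andP[_ rw];
      apply: mem_set; rewrite /= in_itv/= rw ?r0 ?h.
  by rewrite expr2; ring.
under eq_integral do rewrite E2.
rewrite ge0_integralZl//; last 3 first.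
- apply/measurable_EFinP; apply: measurable_funM; first exact: measurable_invr.
  by apply: measurable_indic; exact: measurable_itv.
- move=> r _; rewrite lee_fin indicE.
  have [/set_mem/=|_] := boolP (_ \in _); last by rewrite mulr0.
  by rewrite in_itv/= => /andP[h _]; rewrite mulr1 invr_ge0; lra.
- by rewrite lee_fin mulr_ge0// sqr_ge0.
rewrite [leRHS]EFinM lee_pmul2l//; last by rewrite lte_fin mulr_gt0// exprn_gt0.
have [rw|rw] := leP (rho / 2) w; last first.
  rewrite (_ : (fun _ => _) = cst 0%E) ?integral0 ?lee_fin//.
  apply/funext => r; rewrite indicE memNset ?mulr0//= in_itv/=.
  by move=> /andP[a b]; lra.
apply: (@le_trans _ _ (\int[mu]_(r in `[(rho / 2)%R, w]) (r^-1)%:E)%E).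
  rewrite [leLHS](_ : _ = \int[mu]_(r in `[(rho / 2)%R, w[) (r^-1)%:E)%E.
    apply: ge0_le_integral_subset => r; rewrite /= !in_itv/= => /andP[h1 h2].
      by rewrite h1 (ltW h2) lexx lee_fin invr_ge0; split => //; apply/andP; split => //; lra.
    by rewrite lee_fin invr_ge0; lra.
  apply: eq_integral_ext0 => // r.
  - by move=> _ h; rewrite indicE mem_set ?mulr1.
  - by move=> _ h; rewrite indicE memNset ?mulr0.
  - by move/(_ I).
rewrite integral_invr//; last by lra.
rewrite lee_fin -ln_div ?posrE//; last by lra.
rewrite (_ : w / (rho / 2) = 2 * w / rho); last by field; rewrite gt_eqF.
exact: ler_norm.
Qed.
End cone_energy_integral.

(** * Walls of dislocations *)

Section wall_field.
Context (R : realType) (q w : R) (N : nat).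
Hypothesis w0 : 0 < w.

Definition wall_a (x : R * R) : R := q * cone_a w (ctr w x.2) x.
Definition wall_b (x : R * R) : R := q * cell_b w (ctr w x.2) x.

Definition wallY : R := (2 * N).+1%:R * w.

Definition wall_out : set (R * R) :=
  `[0, +oo[ `*` ~` `[- wallY, wallY[.

(** The truncated wall: the [2 * N + 1] cells between [- wallY] and [wallY], and
    the bare jump [q] outside; it equals [(wall_a, wall_b)] between these heights
    ([wallN_aE], [wallN_bE]). *)
Definition wallN_a (x : R * R) : R :=
  \sum_(i < (2 * N).+1) q * cone_a w (ctrs w i) x.
Definition wallN_b (x : R * R) : R :=
  \sum_(i < (2 * N).+1) q * cell_b w (ctrs w i) x + q * \1_wall_out x.

(** The half-lines may start at a height [Z] below [wallY]: in a square that cuts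
    a cell close to its centre, the cone may have its apex just outside the square, and
    it is then the half-line that removes the singularity from the square. *)
Definition wall_sing (Z : R) : set (R * R) :=
  [set x | x.1 = 0 /\
    (x.2 <= - Z \/ Z <= x.2 \/ exists i, x.2 = @ctrs R w N i)].

Lemma measurable_wall_out :
  measurable (wall_out : set (measurableTypeR R * measurableTypeR R)).
Proof.
by apply: measurableX; [|apply: measurableC]; exact: measurable_itv.
Qed.

Lemma cone_a_cell c (x : R * R) : ~~ (- w <= x.2 - c < w) -> cone_a w c x = 0.
Proof.
move=> h; rewrite /cone_a indicE memNset ?mul0r// => -[/andP[x0 xw] /=].
rewrite ler_norml => /andP[h1 h2]; move/negP: h; apply; have w0' := w0.
by apply/andP; split; lra.
Qed.

Lemma cone_b_cell c (x : R * R) : ~~ (- w <= x.2 - c < w) -> cone_b w c x = 0.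
Proof.
move=> h; rewrite /cone_b indicE memNset ?mul0r// => -[/andP[x0 xw] /=].
rewrite ler_norml => /andP[h1 h2]; move/negP: h; apply; have w0' := w0.
by apply/andP; split; lra.
Qed.

Lemma cell_b_cell c (x : R * R) : ~~ (- w <= x.2 - c < w) -> cell_b w c x = 0.
Proof.
move=> h; rewrite /cell_b cone_b_cell// add0r indicE memNset// => -[_ /=].
rewrite in_itv/= => /andP[h1 h2]; move/negP: h; apply; have w0' := w0.
by apply/andP; split; lra.
Qed.

Lemma wallN_aE x :
  wallN_a x = if - wallY <= x.2 < wallY then wall_a x else 0.
Proof.
rewrite /wallN_a (@sum_ctrs R w w0 N x.2 (fun c => q * cone_a w c x))//.
by move=> c /cone_a_cell ->; rewrite mulr0.
Qed.

Lemma wallN_bE x :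
  wallN_b x = if - wallY <= x.2 < wallY then wall_b x else
              if 0 <= x.1 then q else 0.
Proof.
rewrite /wallN_b (@sum_ctrs R w w0 N x.2 (fun c => q * cell_b w c x)).
  rewrite -/wallY indicE; case: ifPn => h.
    rewrite memNset ?mulr0 ?addr0// => -[_] /=; apply.
    by rewrite in_itv/= h.
  rewrite add0r; case: ifPn => x0.
    rewrite mem_set ?mulr1//; split; rewrite /= in_itv/= ?x0//.
    exact/negP.
  by rewrite memNset ?mulr0// => -[/=]; rewrite in_itv/= (negbTE x0).
by move=> c /cell_b_cell ->; rewrite mulr0.
Qed.

Lemma loc_int_wallN_a : loc_int wallN_a.
Proof. by apply: loc_int_sum => i; apply: loc_intZ; exact: loc_int_cone_a. Qed.

Lemma loc_int_wallN_b : loc_int wallN_b.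
Proof.
apply: (@loc_intD _ (fun x => \sum_(i < (2 * N).+1) q * cell_b w (ctrs w i) x)
  (fun x => q * \1_wall_out x)).
  by apply: loc_int_sum => i; apply: loc_intZ; exact: loc_int_cell_b.
by apply: loc_intZ; apply: loc_int_indic; exact: measurable_wall_out.
Qed.

Lemma pairing_wallN (M : R) (f d1 d2 : R * R -> R) : C1c M f d1 d2 ->
  pairing wallN_a wallN_b d1 d2 =
  2 * q * w * \sum_(i < (2 * N).+1) f (0, ctrs w i) +
  q * Rintegral (@lebesgue_measure R) (~` `[- wallY, wallY[) (fun y => f (0, y)).
Proof.
move=> F.
have la c : loc_int (cone_a w c) by exact: loc_int_cone_a.
have lb c : loc_int (cell_b w c) by exact: loc_int_cell_b.
have lo : loc_int (\1_wall_out : R * R -> R).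
  by apply: loc_int_indic; exact: measurable_wall_out.
have l0 := @loc_int_cst R 0.
rewrite (_ : wallN_a = wallN_a \+ (fun x => q * cst 0 x)); last first.
  by apply/funext => x /=; rewrite mulr0 addr0.
rewrite (pairingD F (b := fun x => \sum_(i < (2 * N).+1) q * cell_b w (ctrs w i) x)
  (b' := fun x => q * \1_wall_out x)); last 4 first.
- exact: loc_int_wallN_a.
- by apply: loc_int_sum => i; exact: loc_intZ.
- exact: loc_intZ.
- exact: loc_intZ.
rewrite (pairingZ F)// (pairing_strip F); last by apply: measurableC; exact: measurable_itv.
rewrite (pairing_sum F); [|by move=> i; exact: loc_intZ..].
congr (_ + _); rewrite mulr_sumr; apply: eq_bigr => i _.
by rewrite (pairingZ F)// (pairing_cell w0 _ F); ring.
Qed.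

Lemma closed_wall_sing Z : closed (wall_sing Z).
Proof.
rewrite (_ : wall_sing Z = (fst @^-1` [set 0]) `&` (snd @^-1` (`]-oo, - Z] `|`
  (`[Z, +oo[ `|` range (@ctrs R w N))))).
  apply: closedI.
    apply: closed_comp => [x _|]; first exact: cvg_fst.
    by rewrite -set_itv1; exact: interval_closed.
  apply: closed_comp => [x _|]; first exact: cvg_snd.
  apply: closedU; first exact: interval_closed.
  apply: closedU; first exact: interval_closed.
  have [+ _] := @accessible_finite_set_closed R; apply.
    by apply: hausdorff_accessible; exact: Rhausdorff.
  exact: finite_image.
apply/seteqP; split => x; rewrite /wall_sing/= !in_itv/= andbT.
  by move=> [-> [h|[h|[i h]]]]; split; auto; right; right; exists i.
by move=> [-> [h|[h|[i _ h]]]]; split; auto; right; right; exists i.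
Qed.

(** Along each half-line [f] is continuous with values 0 and 1 and vanishes far away,
    so by the intermediate value theorem it vanishes on the whole half-line. *)
Lemma pairing_wallN_sing (M Z : R) (f d1 d2 : R * R -> R) : C1c M f d1 d2 ->
  Z <= wallY -> (forall x, wall_sing Z x -> f x = 0 \/ f x = 1) ->
  pairing wallN_a wallN_b d1 d2 =
  2 * q * w * \sum_(i < (2 * N).+1) f (0, ctrs w i).
Proof.
move=> F ZY f01; rewrite (pairing_wallN F).
have cf : continuous (fun y => f (0, y)).
  exact: (continuous_slice2 _ (C1c_cont F)).
have half y : (f (0, y) = 0 \/ f (0, y) = 1) -> f (0, y) != 2^-1.
  by move=> [->|->]; apply/eqP; lra.
have up y : Z <= y -> f (0, y) = 0.
  move=> Yy; have [//|y1] := f01 (0, y) (conj erefl (or_intror (or_introl Yy))).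
  pose z := Num.max y M.
  have yz : y <= z by rewrite le_max lexx.
  have z0 : f (0, z) = 0.
    have [] := C1c_off F (x := (0, z)); last by [].
    by move=> [_ /=]; rewrite in_itv/= => /andP[_]; rewrite ltNge le_max lexx orbT.
  have [] := @IVT _ (fun y => f (0, y)) y z 2^-1 yz.
  - exact: continuous_subspaceT.
  - by rewrite /= y1 z0 minEle maxEle; case: ifP => ?; apply/andP; split; lra.
  move=> u; rewrite in_itv/= => /andP[yu _] /eqP; rewrite (negbTE (half _ _))//.
  by apply: f01; split => //=; right; left; exact: le_trans yu.
have dn y : y <= - Z -> f (0, y) = 0.
  move=> Yy; have [//|y1] := f01 (0, y) (conj erefl (or_introl Yy)).
  pose z := Num.min y (- M).
  have yz : z <= y by rewrite ge_min lexx.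
  have z0 : f (0, z) = 0.
    have [] := C1c_off F (x := (0, z)); last by [].
    by move=> [_ /=]; rewrite in_itv/= => /andP[+ _]; rewrite ltNge ge_min lexx orbT.
  have [] := @IVT _ (fun y => f (0, y)) z y 2^-1 yz.
  - exact: continuous_subspaceT.
  - by rewrite /= y1 z0 minEle maxEle; case: ifP => ?; apply/andP; split; lra.
  move=> u; rewrite in_itv/= => /andP[_ yu] /eqP; rewrite (negbTE (half _ _))//.
  by apply: f01; split => //=; left; exact: le_trans Yy.
rewrite (@eq_Rintegral _ _ _ _ _ (cst 0)).
  rewrite Rintegral_cst ?mul0r ?mulr0 ?addr0//.
  by apply: measurableC; exact: measurable_itv.
move=> y /set_mem /= /negP; rewrite in_itv/= negb_and -ltNge -leNgt => /orP[h|h].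
  by rewrite dn// ltW// (lt_le_trans h)// lerN2.
by apply: up; exact: le_trans h.
Qed.

End wall_field.

(** * Neighbourhoods of the singular set *)

Lemma continuous_enorm (R : realType) : continuous (@enorm R).
Proof.
move=> x; apply: (@continuous_comp _ _ _ (fun x : R * R => x.1 ^+ 2 + x.2 ^+ 2) Num.sqrt).
  apply: (@cvgD R R _ (nbhs x) _ (fun x => x.1 ^+ 2) (fun x => x.2 ^+ 2)).
    apply: (@cvgM R _ (nbhs x) _ fst fst); exact: cvg_fst.
  apply: (@cvgM R _ (nbhs x) _ snd snd); exact: cvg_snd.
exact: sqrt_continuous.
Qed.

Lemma nbhdP (R : realType) (Om S : set (R * R)) (r : R) (x : R * R) :
  nbhd Om r S x <-> Om x /\ exists2 y, S y & enorm (x - y) < r.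
Proof.
split=> -[Ox h]; split => //.
  have [_ [y Sy <-] lt] := ereal_inf_lt h.
  by exists y => //; rewrite -lte_fin.
case: h => y Sy xy; apply: (@le_lt_trans _ _ (enorm (x - y))%:E); last by rewrite lte_fin.
by apply: ereal_inf_lbound; exists y.
Qed.

Lemma measurable_nbhd (R : realType) (Om S : set (R * R)) (r : R) : open Om ->
  measurable (nbhd Om r S : set (measurableTypeR R * measurableTypeR R)).
Proof.
move=> oO; apply: measurable_open2.
rewrite (_ : nbhd Om r S = Om `&` \bigcup_(y in S) [set x | enorm (x - y) < r]).
  apply: openI => //; apply: bigcup_open => y _.
  have c : continuous (fun x : R * R => enorm (x - y)).
    move=> x; apply: (@continuous_comp _ _ _ (fun x : R * R => x - y) (@enorm R)).
      by apply: cvgB; [exact: cvg_id|exact: cvg_cst].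
    exact: continuous_enorm.
  move/continuousP : c => /(_ `]-oo, r[%classic (@interval_open R -oo%O (BLeft r) isT isT)).
  have -> : (fun x : R * R => enorm (x - y)) @^-1` `]-oo, r[ = [set x | enorm (x - y) < r].
    by apply/seteqP; split => x; rewrite /= in_itv.
  exact.
apply/seteqP; split => x.
  by move/nbhdP => [Ox [y Sy xy]]; split => //; exists y.
by move=> [Ox [y Sy xy]]; apply/nbhdP; split => //; exists y.
Qed.

Lemma open_square (R : realType) (L : R) : open (square L).
Proof.
rewrite (_ : square L = (fst @^-1` `]- L, L[) `&` (snd @^-1` `]- L, L[))//.
apply: openI; apply: open_comp => [x _|]; try exact: interval_open.
  exact: cvg_fst.
exact: cvg_snd.
Qed.

Lemma enorm_ge (R : realType) (x : R * R) : `|x.1| <= enorm x /\ `|x.2| <= enorm x.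
Proof.
split; rewrite -sqrtr_sqr /enorm ler_wsqrtr//.
  by rewrite lerDl sqr_ge0.
by rewrite lerDr sqr_ge0.
Qed.

Lemma leb2_rect_le (R : realType) (rho c d m : R) : 0 <= rho -> 0 <= m ->
  d - c <= m ->
  (leb2 R (`](- rho)%R, rho[ `*` `]c, d[) <= (2 * rho * m)%:E)%E.
Proof.
move=> rho0 m0 dcm; rewrite leb2_rect; [|exact: measurable_itv..].
rewrite EFinM; apply: lee_pmul; rewrite ?lee_fin//.
  rewrite lebesgue_measure_itv/=; case: ifP => _; rewrite -?EFinB lee_fin; lra.
by rewrite lebesgue_measure_itv/=; case: ifP => _; rewrite -?EFinB lee_fin.
Qed.

(** * Energy and area of a wall *)

(** What one row contributes to an admissible pair: [row_pair0] places the support of its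
    curl in [F], [row_pairZ] quantizes its circulation around parts of [F], and [E]
    bounds its elastic energy and the area it removes. *)
Record row_competitor (R : realType) (lambda tau eps L q : R) (a b : R * R -> R)
    (F : set (R * R)) (E : R) : Prop := {
  row_int_a : loc_int a;
  row_int_b : loc_int b;
  row_closed : closed F;
  row_pair0 : forall f d1 d2, C1c L f d1 d2 ->
    (forall x, F x -> f x = 0) -> pairing a b d1 d2 = 0;
  row_pairZ : forall f d1 d2, C1c L f d1 d2 ->
    (forall x, F x -> f x = 0 \/ f x = 1) ->
    exists z : int, pairing a b d1 d2 = tau * eps * z%:~R;
  row_area : (leb2 R (nbhd (square L) (lambda * eps) (square L `&` F)) <= E%:E)%E;
  row_energy : (\int[leb2 R]_(x in square L `\`
      nbhd (square L) (lambda * eps) (square L `&` F))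
    (a x ^+ 2 + (b x - q * (0 <= x.1)%R%:R) ^+ 2)%:E <= E%:E)%E }.

Section wall_energy.
Context (R : realType) (q w rho L : R) (N : nat) (Z : R).
Hypotheses (w0 : 0 < w) (rho0 : 0 < rho) (L0 : 0 < L) (ZL : Z <= L - rho).

Let Y := wallY w N.
Let S := square L `&` wall_sing w N Z.
Let B := nbhd (square L) rho S.

(** In the cone both entries are at most [|q| * w / x.1], and off the cone, for
    [0 <= x.1 < w], the row is 0 instead of [(0, q)]. *)
Lemma wall_pointwise x : square L x -> ~ B x ->
  wallN_a q w N x ^+ 2 + (wallN_b q w N x - q * (0 <= x.1)%R%:R) ^+ 2 <=
  q ^+ 2 * \1_(`[0, w[ `*` `]- L, L[) x +
  \sum_(i < (2 * N).+1) 2 * q ^+ 2 * cone_energy w rho (ctrs w i) x.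
Proof.
move=> xL xB; have w0' := w0; have rho0' := rho0.
have rhs0 : 0 <= q ^+ 2 * \1_(`[0, w[ `*` `]- L, L[) x :> R.
  by rewrite mulr_ge0 ?sqr_ge0// indicE ler0n.
rewrite (@sum_ctrs R w w0 N x.2 (fun c => 2 * q ^+ 2 * cone_energy w rho c x)); last first.
  by move=> c /(cone_b_cell w0) h; rewrite /cone_energy h expr0n !mulr0.
rewrite (wallN_aE _ _ w0) (wallN_bE _ _ w0) -/(wallY w N) -/Y.
case: ifPn => yY; last first.
  rewrite addr0 expr0n add0r; case: ifPn => _; rewrite ?mulr1 ?subrr ?mulr0 ?subr0 expr0n//.
have [j ej] := ctr_in_ctrs w0 yY.
rewrite /wall_a /wall_b /cell_b -ej; set c := ctrs w j.
have energy0 : 0 <= 2 * q ^+ 2 * cone_energy w rho c x.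
  by rewrite mulr_ge0 ?cone_energy_ge0// mulr_ge0 ?sqr_ge0.
have /andP[c1 c2] := ctrP w0 x.2; rewrite -ej -/c in c1 c2.
have stripE : \1_(`[0, w[ `*` `]- L, L[) x = (0 <= x.1 < w)%R%:R :> R.
  rewrite indicE; congr ((nat_of_bool _)%:R); apply/idP/idP.
    by move=> /set_mem[/=]; rewrite in_itv.
  by move=> h; apply: mem_set; split; [rewrite /= in_itv|case: xL].
have tailE : \1_(`[w, +oo[ `*` `[c - w, c + w[) x = (w <= x.1)%R%:R :> R.
  rewrite indicE; congr ((nat_of_bool _)%:R); apply/idP/idP.
    by move=> /set_mem[/=]; rewrite in_itv/= andbT.
  move=> h; apply: mem_set; split; rewrite /= in_itv/= ?h//.
  by apply/andP; split; lra.
rewrite tailE stripE.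
have [xc|xc] := pselect (cone w c x); last first.
  have -> : cone_a w c x = 0 by rewrite /cone_a indicE memNset ?mul0r.
  have -> : cone_b w c x = 0 by rewrite /cone_b indicE memNset ?mul0r.
  rewrite mulr0 expr0n add0r add0r.
  have [xn|xp] := leP 0 x.1; have [xw|xw] := leP w x.1 => /=;
    rewrite ?mulr0 ?mulr1 ?subrr ?subr0 ?sub0r ?expr0n ?sqrrN ?add0r//; try lra.
have [/andP[x0 xw] yc] := xc.
(* If the apex lies in the square, it is singular, hence at distance at least rho
   from x. Otherwise, either x lies in a horizontal line that meets a singular half-line
   inside the square, or its height differs from c by at least rho. *)
have xrho : rho / 2 <= x.1.
  have nB y : square L (0, y) -> wall_sing w N Z (0, y) -> rho <= enorm (x - (0, y)).
    move=> sy Fy; rewrite leNgt; apply/negP => h; apply: xB; apply/nbhdP; split => //.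
    by exists (0, y).
  have sq y : (- L < y < L) -> square L (0, y).
    move=> yL; split; rewrite /= in_itv/= ?yL//; apply/andP; split; have := L0; lra.
  have Bx y : enorm (x - (0, y)) ^+ 2 = x.1 ^+ 2 + (x.2 - y) ^+ 2.
    by rewrite sqr_sqrtr ?addr_ge0 ?sqr_ge0//= subr0.
  have en0 y : 0 <= enorm (x - (0, y)) by exact: sqrtr_ge0.
  case: (xL) => _ /=; rewrite in_itv/= => /andP[xL1 xL2].
  have zz := ZL.
  move: yc; rewrite ler_norml => /andP[yc1 yc2].
  have same : wall_sing w N Z (0, x.2) -> rho / 2 <= x.1.
    move=> h; have := nB x.2 (sq _ (introT andP (conj xL1 xL2))) h.
    have := Bx x.2; rewrite subrr expr0n addr0 => e.
    have := en0 x.2; nra.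
  have [Lc|cL] := leP L c.
    have [xx|xx] := leP (L - rho) x.2; last by lra.
    by apply: same; split => //=; right; left; lra.
  have [cL'|Lc'] := leP c (- L).
    have [xx|xx] := leP x.2 (- (L - rho)); last by lra.
    by apply: same; split => //=; left; lra.
  have h : rho <= enorm (x - (0, c)).
    apply: nB; first by apply: sq; rewrite Lc' cL.
    by split => //=; right; right; exists j.
  have h2 : rho ^+ 2 <= x.1 ^+ 2 + (x.2 - c) ^+ 2.
    by rewrite -Bx ler_sqr ?nnegrE// ltW.
  nra.
have cE : cone_b w c x = w / x.1 by rewrite /cone_b indicE mem_set// mul1r.
have aE : cone_a w c x = - w * (x.2 - c) / x.1 ^+ 2.
  by rewrite /cone_a indicE mem_set// mul1r.
have energyE : cone_energy w rho c x = (w / x.1) ^+ 2.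
  rewrite /cone_energy cE indicE mem_set ?mul1r//; split => //=.
  by rewrite in_itv/= xrho.
have tail0 : (w <= x.1) = false by apply/negbTE; rewrite -ltNge.
rewrite cE aE energyE tail0 (ltW x0) xw mulr1 addr0.
(* With t >= 1 and |s| <= 1 the claim is (t s)^2 + (t - 1)^2 <= 1 + 2 t^2. *)
have [t tE] : exists t, t = w / x.1 by eexists.
have [s sE] : exists s, s = (x.2 - c) / x.1 by eexists.
have t1 : 1 <= t by rewrite tE ler_pdivlMr// mul1r ltW.
have s1 : -1 <= s <= 1.
  move: yc; rewrite ler_norml sE => /andP[y1 y2].
  by rewrite ler_pdivlMr// ler_pdivrMr// mulN1r mul1r y1.
rewrite (_ : - w * (x.2 - c) / x.1 ^+ 2 = - (t * s)); last first.
  by rewrite tE sE; field; rewrite gt_eqF.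
rewrite -tE; case/andP: s1 => s1 s2.
have ss : s ^+ 2 <= 1 by nra.
have tt : 0 <= t ^+ 2 by exact: sqr_ge0.
have qq : 0 <= q ^+ 2 by exact: sqr_ge0.
have h1 : (t * s) ^+ 2 + (t - 1) ^+ 2 <= 1 + 2 * t ^+ 2 by nra.
have := ler_wpM2l qq h1; rewrite /= => h3; lra.
Qed.
End wall_energy.

Section wall_bounds.
Context (R : realType) (q w rho L : R) (N : nat) (Z : R).
Hypotheses (w0 : 0 < w) (rho0 : 0 < rho) (L0 : 0 < L) (ZL : Z <= L - rho).

Let S := square L `&` wall_sing w N Z.
Let B := nbhd (square L) rho S.

Lemma wall_energy_le :
  (\int[leb2 R]_(x in square L `\` B)
    (wallN_a q w N x ^+ 2 + (wallN_b q w N x - q * (0 <= x.1)%R%:R) ^+ 2)%:E <=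
   (q ^+ 2 * (w * (2 * L)) +
    (2 * N).+1%:R * (4 * q ^+ 2 * w ^+ 2 * `|ln (2 * w / rho)|))%:E)%E.
Proof.
pose J : set (R * R) := `[0, w[ `*` `]- L, L[.
have mJ : measurable (J : set (measurableTypeR R * measurableTypeR R)).
  by apply: measurableX; exact: measurable_itv.
pose g0 (x : R * R) : \bar R := ((q ^+ 2)%:E * (\1_J x)%:E)%E.
pose g1 (i : 'I_(2 * N).+1) (x : R * R) : \bar R :=
  ((2 * q ^+ 2)%:E * (cone_energy w rho (ctrs w i) x)%:E)%E.
have g00 x : (0 <= g0 x)%E.
  by rewrite mule_ge0// lee_fin ?sqr_ge0// indicE ler0n.
have g10 i x : (0 <= g1 i x)%E.
  apply: mule_ge0; rewrite lee_fin; last exact: cone_energy_ge0.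
  by rewrite mulr_ge0 ?sqr_ge0.
have mg0 : measurable_fun [set: measurableTypeR R * measurableTypeR R] g0.
  by apply: measurable_funeM; apply/measurable_EFinP; exact: measurable_indic.
have mg1 i : measurable_fun [set: measurableTypeR R * measurableTypeR R] (g1 i).
  by apply: measurable_funeM; apply/measurable_EFinP; exact: measurable_cone_energy.
apply: (@le_trans _ _ (\int[leb2 R]_x (g0 x + \sum_(i < (2 * N).+1) g1 i x))%E).
  apply: ge0_le_integral_subset => x; last first.
    by move=> _; apply: adde_ge0 => //; apply: sume_ge0 => i _.
  move=> [xL xB]; split => //; apply/andP; split.
    by rewrite lee_fin addr_ge0 ?sqr_ge0.
  have := wall_pointwise q w0 rho0 L0 ZL xL xB.
  rewrite -lee_fin => /le_trans; apply.
  by rewrite EFinD -sumEFin EFinM.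
rewrite ge0_integralD//; last 2 first.
- by move=> x _; apply: sume_ge0.
- exact: emeasurable_sum.
rewrite EFinD; apply: leeD.
  rewrite ge0_integralZl; last 4 first.
  - by [].
  - by apply/measurable_EFinP; exact: measurable_indic.
  - by move=> x _; rewrite lee_fin indicE ler0n.
  - by rewrite lee_fin sqr_ge0.
  rewrite integral_indic// setIT leb2_rect; [|exact: measurable_itv..].
  rewrite !lebesgue_measure_itv/= !lte_fin w0.
  have -> : - L < L by have := L0; lra.
  by rewrite -!EFinB -!EFinM lee_fin le_eqVlt; apply/orP; left; apply/eqP; ring.
rewrite ge0_integral_sum//.
apply: (@le_trans _ _ (\sum_(i < (2 * N).+1)
    (4 * q ^+ 2 * w ^+ 2 * `|ln (2 * w / rho)|)%:E)%E).
  apply: lee_sum => i _.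
  rewrite ge0_integralZl; last 4 first.
  - by [].
  - by apply/measurable_EFinP; exact: measurable_cone_energy.
  - by move=> x _; rewrite lee_fin cone_energy_ge0.
  - by rewrite lee_fin mulr_ge0// sqr_ge0.
  apply: (le_trans (lee_wpmul2l _ (integral_cone_energy w0 rho0 _))).
    by rewrite lee_fin mulr_ge0// sqr_ge0.
  by rewrite -EFinM lee_fin le_eqVlt; apply/orP; left; apply/eqP; ring.
by rewrite sumEFin sumr_const card_ord lee_fin -[leLHS]mulr_natl.
Qed.

(** A disc around each centre, and the [rho]-neighbourhood of two segments of length
    at most [L - Z]. *)
Lemma wall_area_le (m : R) : 0 <= m -> L - Z + rho <= m ->
  (leb2 R B <= ((2 * N).+1%:R * (4 * rho ^+ 2) + 4 * rho * m)%:E)%E.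
Proof.
move=> m0 Zm.
pose J (c d : R) : set (R * R) := `]- rho, rho[ `*` `]c, d[.
have mJ c d : measurable (J c d : set (measurableTypeR R * measurableTypeR R)).
  by apply: measurableX; exact: measurable_itv.
pose g0 (x : R * R) : \bar R :=
  ((\1_(J (Z - rho) L) x)%:E + (\1_(J (- L) (- Z + rho)) x)%:E)%E.
pose g1 (i : 'I_(2 * N).+1) (x : R * R) : \bar R :=
  (\1_(J (ctrs w i - rho) (ctrs w i + rho)) x)%:E.
have i0 (K : set (R * R)) x : (0 <= (\1_K x : R)%:E)%E.
  by rewrite lee_fin indicE ler0n.
have mi c d : measurable_fun [set: measurableTypeR R * measurableTypeR R]
    (fun x => (\1_(J c d) x : R)%:E).
  by apply/measurable_EFinP; exact: measurable_indic.
have g00 x : (0 <= g0 x)%E by exact: adde_ge0.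
have mg0 : measurable_fun [set: measurableTypeR R * measurableTypeR R] g0.
  exact: emeasurable_funD.
have mB := @measurable_nbhd _ (square L) S rho (@open_square R L).
have -> : leb2 R B = (\int[leb2 R]_(x in B) 1)%E.
  by rewrite integral_cst// mul1e.
apply: (@le_trans _ _ (\int[leb2 R]_x (g0 x + \sum_(i < (2 * N).+1) g1 i x))%E).
  apply: ge0_le_integral_subset => x; last first.
    by move=> _; apply: adde_ge0 => //; apply: sume_ge0 => i _; exact: i0.
  move=> /nbhdP[[xL1 xL2] [y [yL [y1 yF]] xy]]; split => //; rewrite lee01/=.
  have s0 : (0 <= \sum_(i < (2 * N).+1) g1 i x)%E.
    by apply: sume_ge0 => i _; exact: i0.
  have [h1 h2] := enorm_ge (x - y).
  have {}h1 := le_lt_trans h1 xy; have {}h2 := le_lt_trans h2 xy.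
  move: h1 h2; rewrite /= y1 subr0 !ltr_norml => /andP[a1 a2] /andP[b1 b2].
  move: xL2; rewrite /= in_itv/= => /andP[l1 l2].
  have inJ c d : c < x.2 < d -> (\1_(J c d) x : R) = 1.
    move=> h; rewrite indicE mem_set//; split; rewrite /= in_itv//=.
    by rewrite a1 a2.
  case: yF => [h|[h|[i h]]].
  - rewrite /g0 (inJ (- L)); last by apply/andP; split; lra.
    by rewrite -[leLHS]adde0; apply: leeD => //; rewrite -[leLHS]add0e; apply: leeD.
  - rewrite /g0 (inJ (Z - rho)); last by apply/andP; split; lra.
    by rewrite -[leLHS]adde0; apply: leeD => //; rewrite -[leLHS]adde0; apply: leeD.
  - rewrite (bigD1 i)//= /g1 inJ; last by apply/andP; split; lra.
    rewrite -[leLHS]add0e; apply: leeD => //; rewrite -[leLHS]adde0; apply: leeD => //.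
    by apply: sume_ge0 => k _; exact: i0.
rewrite ge0_integralD//; last 2 first.
- by move=> x _; apply: sume_ge0 => i _; exact: i0.
- by apply: emeasurable_sum => i; exact: mi.
rewrite ge0_integralD// ge0_integral_sum//; last 2 first.
- by move=> i; exact: mi.
- by move=> i x _; exact: i0.
rewrite !integral_indic// !setIT addeC EFinD; apply: leeD.
  apply: (@le_trans _ _ (\sum_(i < (2 * N).+1) (4 * rho ^+ 2)%:E)%E).
    apply: lee_sum => i _; rewrite integral_indic// setIT.
    rewrite (_ : 4 * rho ^+ 2 = 2 * rho * (2 * rho)); last by ring.
    apply: leb2_rect_le; have := rho0; lra.
  by rewrite sumEFin sumr_const card_ord lee_fin -[leLHS]mulr_natl.
rewrite (_ : 4 * rho * m = 2 * rho * m + 2 * rho * m); last by ring.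
rewrite EFinD; apply: leeD; apply: leb2_rect_le => //; have := rho0; lra.
Qed.

End wall_bounds.

(** * Competitors for one row *)

Lemma zero_row (R : realType) (lambda tau eps L : R) :
  row_competitor lambda tau eps L 0 (cst 0) (cst 0) set0 0.
Proof.
have n0 : nbhd (square L) (lambda * eps) (square L `&` set0) = set0.
  rewrite setI0; apply/seteqP; split => // x /nbhdP[_ [y]].
  by [].
split.
- exact: loc_int_cst.
- exact: loc_int_cst.
- exact: closed0.
- by move=> f d1 d2 F _; exact: pairing_cst F 0 0.
- by move=> f d1 d2 F _; exists 0; rewrite (pairing_cst F 0 0) mulr0.
- by rewrite n0 measure0.
- rewrite (eq_integral (cst 0%E)) ?integral0// => x _ /=.
  by rewrite mul0r subr0 expr0n addr0.
Qed.

Definition wall_const (R : realType) (lambda tau : R) : R :=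
  tau + 6 * tau * (1 + `|ln (tau / lambda)|) + 24 * lambda ^+ 2 / tau + 1.

Lemma wall_const_gt0 (R : realType) (lambda tau : R) :
  0 < lambda -> 0 < tau -> 0 < wall_const lambda tau.
Proof.
move=> l0 t0; rewrite /wall_const.
have h1 : 0 <= tau * `|ln (tau / lambda)| by rewrite mulr_ge0// ltW.
have h2 : 0 <= 24 * lambda ^+ 2 / tau by rewrite divr_ge0 ?mulr_ge0 ?sqr_ge0// ltW.
lra.
Qed.

(** The half-height for which a cell carries a charge [2 * q * w] equal to
    [+-tau * eps]. *)
Definition half_cell (R : realType) (tau eps q : R) : R := tau * eps / (2 * `|q|).

(** The first condition on [N] bounds the number of cells by a multiple of
    [L * |q| / (tau * eps)]; the second one leaves at most three cells of bare jump
    at either end, a bounded area absorbed by [L > h]. *)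
Lemma wall_row (R : realType) (lambda tau eps q : R) :
  0 < lambda -> 0 < tau -> 0 < eps -> q != 0 ->
  let w := half_cell tau eps q in
  exists2 h, 2 * w <= h & forall (L : R) (N : nat), h < L ->
    N%:R <= L / (2 * w) + 1 -> L - 6 * w <= wallY w N ->
    row_competitor lambda tau eps L q (wallN_a q w N) (wallN_b q w N)
      (wall_sing w N (Num.min (wallY w N) (L - lambda * eps)))
      (wall_const lambda tau * eps * L * (`|q| * (1 + `|ln `|q| |))).
Proof.
move=> lambda0 tau0 eps0 q0 w.
have qn : 0 < `|q| by rewrite normr_gt0.
have w0 : 0 < w by rewrite divr_gt0 ?mulr_gt0.
pose rho := lambda * eps.
have rho0 : 0 < rho by rewrite mulr_gt0.
pose h := 2 * w + 4 * rho * (6 * w + 2 * rho) / (eps * `|q|).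
have wh : 2 * w <= h.
  by rewrite lerDl divr_ge0 ?mulr_ge0 ?addr_ge0 ?mulr_ge0// ltW// mulr_gt0.
exists h => // L N hL NL YL.
have L0 : 0 < L by rewrite (lt_trans _ hL)// (lt_le_trans _ wh)// mulr_gt0.
set Z := Num.min _ _.
have ZL : Z <= L - rho by rewrite ge_min lexx orbT.
have ZY : Z <= wallY w N by rewrite ge_min lexx.
have qw : `|q| * w = tau * eps / 2 by rewrite /w /half_cell; field; rewrite gt_eqF.
have twqw : exists s : int, 2 * q * w = tau * eps * s%:~R.
  have [qp|qm] := ltP 0 q.
    by exists 1; rewrite mulr1 -mulrA -{1}(gtr0_norm qp) qw; field.
  exists (-1); rewrite -mulrA -[q]opprK -(ler0_norm qm) mulNr qw rmorphN/=.
  by field.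
have pairE f d1 d2 : C1c L f d1 d2 ->
    (forall x, wall_sing w N Z x -> f x = 0 \/ f x = 1) ->
    pairing (wallN_a q w N) (wallN_b q w N) d1 d2 =
    2 * q * w * \sum_(i < (2 * N).+1) f (0, ctrs w i).
  by move=> F fS; apply: (@pairing_wallN_sing _ q w N w0 L Z _ _ _ F ZY fS).
have sing (i : 'I_(2 * N).+1) : wall_sing w N Z (0, ctrs w i).
  by split => //=; right; right; exists i.
have N2 : (2 * N).+1%:R <= 6 * L * `|q| / (tau * eps).
  have Lw : 2 * w <= L by rewrite (le_trans wh)// ltW.
  have -> : 6 * L * `|q| / (tau * eps) = 3 * (L / w).
    by rewrite /w /half_cell; field; rewrite !gt_eqF.
  have e1 : L / (2 * w) = (L / w) / 2 by field; rewrite gt_eqF.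
  have e2 : 2 <= L / w by rewrite ler_pdivlMr.
  rewrite -natr1 natrM; rewrite e1 in NL; lra.
have qw2 : q ^+ 2 * w = `|q| * (tau * eps / 2).
  by rewrite -qw -[q ^+ 2]real_normK ?num_real// expr2 mulrA.
have qqww : 4 * q ^+ 2 * w ^+ 2 = (tau * eps) ^+ 2.
  rewrite -[q ^+ 2]real_normK ?num_real//.
  rewrite (_ : 4 * `|q| ^+ 2 * w ^+ 2 = 4 * (`|q| * w) ^+ 2); last by ring.
  by rewrite qw; field.
have te0 : 0 < tau * eps by rewrite mulr_gt0.
have lnE : `|ln (2 * w / rho)| <= `|ln (tau / lambda)| + `|ln `|q| |.
  have -> : 2 * w / rho = tau / lambda / `|q|.
    by rewrite /w /rho /half_cell; field; rewrite !gt_eqF.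
  have -> : ln (tau / lambda / `|q|) = ln (tau / lambda) - ln `|q|.
    by apply: ln_div; rewrite posrE// divr_gt0.
  exact: ler_normB.
have G0 : 0 <= `|ln `|q| | by [].
have T0 : 0 <= `|ln (tau / lambda)| by [].
have c24 : 0 <= 24 * lambda ^+ 2 / tau.
  by rewrite divr_ge0 ?mulr_ge0 ?sqr_ge0// ltW.
split.
- exact: loc_int_wallN_a.
- exact: loc_int_wallN_b.
- exact: closed_wall_sing.
- move=> f d1 d2 F f0; rewrite (pairE f)//; last by move=> x /f0; left.
  by rewrite big1 ?mulr0// => i _; exact: f0.
- move=> f d1 d2 F f01; rewrite (pairE f)//.
  have [s ->] := twqw.
  exists (s * \sum_(i < (2 * N).+1) (f (0, ctrs w i) == 1)%:R).
  rewrite rmorphM/= mulrA; congr (_ * _); rewrite rmorph_sum/=; apply: eq_bigr => i _.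
  by have [->|->] := f01 _ (sing i); rewrite ?eqxx// eq_sym oner_eq0.
- apply: (le_trans (@wall_area_le _ w rho L N Z rho0 (6 * w + 2 * rho) _ _)).
  + by rewrite addr_ge0 ?mulr_ge0// ltW.
  + rewrite /Z -/rho minEle; move: w0 rho0 YL => ? ? ?; case: ifP => _; lra.
  rewrite lee_fin.
  have a1 : (2 * N).+1%:R * (4 * rho ^+ 2) <= eps * L * `|q| * (24 * lambda ^+ 2 / tau).
    apply: (le_trans (ler_wpM2r _ N2)); first by rewrite mulr_ge0// sqr_ge0.
    by rewrite le_eqVlt; apply/orP; left; apply/eqP; rewrite /rho; field; rewrite !gt_eqF.
  have a2 : 4 * rho * (6 * w + 2 * rho) <= eps * L * `|q|.
    have : 4 * rho * (6 * w + 2 * rho) / (eps * `|q|) <= L.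
      by rewrite (le_trans _ (ltW hL))// lerDr mulr_ge0// ltW.
    rewrite ler_pdivrMr ?mulr_gt0//.
    by rewrite (_ : eps * L * `|q| = L * (eps * `|q|)); last by ring.
  have X0 : 0 <= eps * L * `|q| by rewrite !mulr_ge0// ltW.
  apply: (@le_trans _ _ (eps * L * `|q| * (24 * lambda ^+ 2 / tau + 1))); first lra.
  rewrite (_ : wall_const lambda tau * eps * L * (`|q| * (1 + `|ln `|q| |)) =
     eps * L * `|q| * (wall_const lambda tau * (1 + `|ln `|q| |))); last by ring.
  apply: ler_wpM2l => //.
  have W0 := ltW (wall_const_gt0 lambda0 tau0).
  apply: (@le_trans _ _ (wall_const lambda tau)); last by rewrite ler_peMr// lerDl.
  by rewrite /wall_const; nra.
- apply: (le_trans (@wall_energy_le _ q w rho L N Z w0 rho0 L0 ZL)).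
  rewrite lee_fin qqww.
  have X0 : 0 <= eps * L * `|q| by rewrite !mulr_ge0// ltW.
  have a1 : q ^+ 2 * (w * (2 * L)) = eps * L * `|q| * tau.
    by rewrite mulrA qw2; field.
  have a2 : (2 * N).+1%:R * ((tau * eps) ^+ 2 * `|ln (2 * w / rho)|) <=
      eps * L * `|q| * (6 * tau * (`|ln (tau / lambda)| + `|ln `|q| |)).
    apply: (@le_trans _ _ ((6 * L * `|q| / (tau * eps)) *
       ((tau * eps) ^+ 2 * (`|ln (tau / lambda)| + `|ln `|q| |)))).
      apply: ler_pM => //; first by rewrite mulr_ge0// sqr_ge0.
      by apply: ler_wpM2l => //; exact: sqr_ge0.
    by rewrite le_eqVlt; apply/orP; left; apply/eqP; field; rewrite !gt_eqF.
  rewrite a1; apply: (le_trans (lerD (lexx _) a2)); rewrite -mulrDr.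
  rewrite (_ : wall_const lambda tau * eps * L * (`|q| * (1 + `|ln `|q| |)) =
     eps * L * `|q| * (wall_const lambda tau * (1 + `|ln `|q| |))); last by ring.
  apply: ler_wpM2l => //.
  have t1 : 0 <= tau * `|ln (tau / lambda)| by rewrite mulr_ge0// ltW.
  have t2 : 0 <= tau * `|ln (tau / lambda)| * `|ln `|q| | by rewrite mulr_ge0.
  have t3 : 0 <= tau * `|ln `|q| | by rewrite mulr_ge0// ltW.
  have t4 : 0 <= 24 * lambda ^+ 2 / tau * `|ln `|q| | by rewrite mulr_ge0.
  rewrite /wall_const; lra.
Qed.

(** * Admissibility and energy of two rows *)

Lemma ord2_cases (i : 'I_2) : i = 0 \/ i = 1.
Proof. by case: i => [[|[|i]] il]//; [left|right]; apply: val_inj. Qed.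

Lemma dist_SO2_le (R : realType) (A B : 'M[R]_2) :
  SO2 B -> dist_SO2 A ^+ 2 <= frob (A - B) ^+ 2.
Proof.
move=> SB.
have lb : lbound [set frob (A - B) | B in @SO2 R] 0.
  by move=> _ [C _ <-]; exact: sqrtr_ge0.
have ge0 : 0 <= dist_SO2 A by apply: lb_le_inf => //; exists (frob (A - B)); exists B.
rewrite ler_sqr ?nnegrE ?sqrtr_ge0//.
by apply: ge_inf; [exists 0|exists B].
Qed.

Lemma frob_sqr (R : realType) (A : 'M[R]_2) :
  frob A ^+ 2 = A 0 0 ^+ 2 + A 0 1 ^+ 2 + (A 1 0 ^+ 2 + A 1 1 ^+ 2).
Proof.
rewrite sqr_sqrtr; last by apply: sumr_ge0 => i _; apply: sumr_ge0 => j _; exact: sqr_ge0.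
by rewrite !big_ord_recl !big_ord0 !addr0; congr (_ ^+ 2 + _ ^+ 2 + (_ ^+ 2 + _ ^+ 2));
  congr (A _ _); apply: val_inj.
Qed.

Section two_rows.
Context (R : realType) (lambda tau eps L : R) (Rm Rp : 'M[R]_2).
Variables (a b : 'I_2 -> R * R -> R) (F : 'I_2 -> set (R * R)) (E : 'I_2 -> R).
Variable A : R * R -> 'M[R]_2.
Let J (i : 'I_2) : R := (Rp - Rm) i 1.
Hypothesis rows : forall i, row_competitor lambda tau eps L (J i) (a i) (b i) (F i) (E i).
Hypothesis SRm : SO2 Rm.
Hypothesis SRp : SO2 Rp.
Hypothesis A0 : forall x i, square L x ->
  A x i 0 = Rm i 0 + (Rp - Rm) i 0 * \1_(`[0, +oo[ `*` setT) x + a i x.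
Hypothesis A1 : forall x i, square L x -> A x i 1 = Rm i 1 + b i x.

Let S := square L `&` (F 0 `|` F 1).

Let ia i := row_int_a (rows i).
Let ib i := row_int_b (rows i).

Let iA0 i : loc_int ((cst (Rm i 0) : R * R -> R) \+
  (fun x => (Rp - Rm) i 0 * \1_(`[0, +oo[ `*` setT) x)).
Proof.
apply: loc_intD; first exact: loc_int_cst.
by apply: loc_intZ; apply: loc_int_indic; exact: measurable_halfplane.
Qed.

Lemma two_rows_L1 : L1 (square L) A.
Proof.
move=> i j; have [->|->] := ord2_cases j.
- apply: eq_integrable (loc_intD (iA0 i) (ia i) L); first exact: measurable_square.
  by move=> x /set_mem xL /=; rewrite A0.
- apply: eq_integrable (loc_intD (loc_int_cst (Rm i 1)) (ib i) L).
    exact: measurable_square.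
  by move=> x /set_mem xL /=; rewrite A1.
Qed.

Lemma two_rows_pairing phi i : test_function (square L) phi ->
  curl_pairing (square L) A phi i 0 = pairing (a i) (b i) (partial1 phi) (partial2 phi).
Proof.
move=> /test_function_C1c C; rewrite /curl_pairing mxE.
transitivity (pairing (fun x => A x i 0) (fun x => A x i 1) (partial1 phi) (partial2 phi)).
  rewrite /pairing Rintegral_mkcond; apply: eq_Rintegral => x _; rewrite patchE.
  case: ifPn => [/set_mem xL|/negP xL].
    rewrite mxE !big_ord_recl big_ord0 addr0 /grad_perp !mxE/=.
    by rewrite mulrN; congr (_ * _ - _ * _); congr (A x i _); apply: val_inj.
  have [|_ -> ->] := C1c_off C (x := x); first by move=> h; apply: xL; rewrite mem_set.
  by rewrite !mulr0 subr0.
rewrite (pairing_eq_square C (a' := ((cst (Rm i 0) : R * R -> R) \+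
  (fun x => (Rp - Rm) i 0 * \1_(`[0, +oo[ `*` setT) x)) \+ a i)
  (b' := (cst (Rm i 1) \+ (fun x => (Rp - Rm) i 0 * cst 0 x)) \+ b i)); last first.
  by move=> x xL; rewrite A0// A1//= mulr0 addr0.
have l0 := @loc_int_cst R 0.
have l1 : loc_int (\1_(`[0, +oo[ `*` setT) : R * R -> R).
  by apply: loc_int_indic; exact: measurable_halfplane.
have lc k := @loc_int_cst R k.
have ib0 : loc_int ((cst (Rm i 1) : R * R -> R) \+ (fun x => (Rp - Rm) i 0 * cst 0 x)).
  by apply: loc_intD => //; exact: loc_intZ.
rewrite (pairingD C)// (pairingD C)//; try exact: loc_intZ.
by rewrite (pairingZ C)// (pairing_cst C) (pairing_cst_halfplane C) mulr0 !add0r.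
Qed.

(** A test function supported off the singular set pairs to 0 with each row, and one
    that is a cutoff for an enclosed domain takes values in {0, 1} on the singular
    set; the sign of the curve only changes the sign of an integer. *)
Lemma two_rows_admissible : admissible tau eps (square L) A S.
Proof.
split.
- exact: two_rows_L1.
- exists (F 0 `|` F 1) => //.
  by apply: closedU; [exact: row_closed (rows 0)|exact: row_closed (rows 1)].
- move=> x [xL xU]; apply: contrapT => xS.
  pose U := square L `&` ~` (F 0 `|` F 1).
  have oU : open U.
    apply: openI; first exact: open_square.
    apply: closed_openC; apply: closedU.
      exact: row_closed (rows 0).
    exact: row_closed (rows 1).
  have [||phi tU] := xU U oU.
  + by split => // h; apply: xS.
  + by move=> y [].
  have tL : test_function (square L) phi.
    by case: tU => s1 s2 s3; split => // y /s3 [].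
  move=> /eqP; apply; apply/matrixP => i j; rewrite ord1 two_rows_pairing// mxE.
  apply: (row_pair0 (rows i) (test_function_C1c tL)) => y Fy.
  apply/eqP/negPn/negP => py.
  have sy : supp phi y by exact: subset_closure.
  case: tU => _ _ /(_ y sy) [_]; apply.
  by have [e|e] := ord2_cases i; rewrite e in Fy; [left|right].
move=> g _ _ D oD DL _ phi tL phi1 phiS.
have f01 i y : F i y -> phi y = 0 \/ phi y = 1.
  move=> Fy; have [/phi1|nD] := pselect (D y); first by right.
  left; apply/eqP/negPn/negP => py.
  have sy : supp phi y by exact: subset_closure.
  have [] := phiS y (conj sy nD).
  move=> yL; apply; split => //.
  by have [e|e] := ord2_cases i; rewrite e in Fy; [left|right].
have zi i := row_pairZ (rows i) (test_function_C1c tL) (f01 i).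
have [z zE] : exists z : 'I_2 -> int, forall i,
    pairing (a i) (b i) (partial1 phi) (partial2 phi) = tau * eps * (z i)%:~R.
  by exists (fun i => projT1 (cid (zi i))) => i; exact: projT2 (cid (zi i)).
have [s sE] : exists s : int, - sgn_curve g D = s%:~R.
  rewrite /sgn_curve; case: ifP => _; first by exists (-1); rewrite rmorphN.
  by exists 1; rewrite opprK.
exists (\col_i (s * z i)) => //.
apply/matrixP => i j; rewrite (ord1 j) [RHS]mxE sE two_rows_pairing// zE !mxE rmorphM/=; ring.
Qed.

(** The rotation [Rm], respectively [Rp], is a competitor in the distance to [SO2] on
    each side of [x.1 = 0]; the difference to it splits into the two rows. *)
Lemma two_rows_Feps : 0 < eps ->
  (Feps lambda tau eps A (square L) <= (eps^-1 * (2 * (E 0 + E 1)))%:E)%E.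
Proof.
move=> eps0; rewrite /Feps EFinM; apply: lee_wpmul2l; first by rewrite lee_fin invr_ge0 ltW.
apply: (@le_trans _ _ (energy lambda eps (square L) A S)).
  by apply: ereal_inf_lbound; exists S => //; exact: two_rows_admissible.
pose B i := nbhd (square L) (lambda * eps) (square L `&` F i).
have BE : nbhd (square L) (lambda * eps) S = B 0 `|` B 1.
  apply/seteqP; split => x.
    move/nbhdP => [xL [y [yL [yF|yF]] xy]]; [left|right]; apply/nbhdP; split => //;
      by exists y.
  by move=> [] /nbhdP [xL [y [yL yF] xy]]; apply/nbhdP; split => //; exists y => //;
    split => //; [left|right].
have mB i : measurable (B i : set (measurableTypeR R * measurableTypeR R)).
  by apply: measurable_nbhd; exact: open_square.
pose e i (x : R * R) : \bar R :=
  (a i x ^+ 2 + (b i x - J i * (0 <= x.1)%R%:R) ^+ 2)%:E.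
have e0 i x : (0 <= e i x)%E by rewrite lee_fin addr_ge0 ?sqr_ge0.
have mS := measurable_square L.
have mi i : measurable_fun (square L : set (measurableTypeR R * measurableTypeR R)) (e i).
  apply/measurable_EFinP; apply: measurable_funD; apply: measurable_funX.
    by apply/measurable_EFinP; exact: measurable_int (ia i L).
  apply: measurable_funB.
    by apply/measurable_EFinP; exact: measurable_int (ib i L).
  rewrite (_ : (fun _ => _) = (fun x => J i * \1_(`[0, +oo[ `*` setT) x)).
    apply: measurable_funM => //; apply: measurable_indic.
    exact: measurable_halfplane.
  by apply/funext => x; rewrite indic_halfplane.
have mD : measurable (square L `\` (B 0 `|` B 1) : set (measurableTypeR R * measurableTypeR R)).
  by apply: measurableD => //; exact: measurableU.
rewrite /energy BE (_ : 2 * (E 0 + E 1) = E 0 + E 1 + (E 0 + E 1)); last by ring.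
rewrite EFinD; apply: leeD; last first.
  apply: (le_trans (measureU2 _ (mB 0) (mB 1))).
  by rewrite EFinD; apply: leeD; [exact: row_area (rows 0)|exact: row_area (rows 1)].
apply: (@le_trans _ _ (\int[leb2 R]_(x in square L `\` (B 0%R `|` B 1%R))
    (e 0%R x + e 1%R x))%E).
  apply: ge0_le_integral_subset => x; last by move=> _; exact: adde_ge0.
  move=> [xL xB]; split => //; rewrite lee_fin sqr_ge0/= /e -EFinD lee_fin.
  have [xn|xp] := ltP x.1 0.
    apply: (le_trans (dist_SO2_le _ SRm)); rewrite frob_sqr !mxE !A0// !A1//.
    rewrite indic_halfplane [0 <= x.1]leNgt xn.
    by rewrite /= !mulr0 le_eqVlt; apply/orP; left; apply/eqP; ring.
  apply: (le_trans (dist_SO2_le _ SRp)); rewrite frob_sqr !mxE !A0// !A1//.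
  rewrite indic_halfplane xp.
  by rewrite /J !mxE /= le_eqVlt; apply/orP; left; apply/eqP; ring.
have sub : square L `\` (B 0 `|` B 1) `<=` square L by move=> x [].
rewrite ge0_integralD//; last 2 first.
- exact: measurable_funS (mi 0).
- exact: measurable_funS (mi 1).
rewrite EFinD; apply: leeD.
  apply: (le_trans _ (row_energy (rows 0))); apply: ge0_le_integral_subset => x.
    by move=> [xL xB]; split; [split => // h; apply: xB; left|rewrite e0 lexx].
  by move=> _; exact: e0.
apply: (le_trans _ (row_energy (rows 1))); apply: ge0_le_integral_subset => x.
  by move=> [xL xB]; split; [split => // h; apply: xB; right|rewrite e0 lexx].
by move=> _; exact: e0.
Qed.

End two_rows.

(** * Infinite and finite walls *)

(** From [|ln s| <= |ln t| + ln (t / s)] and [s * ln (t / s) <= t - s]. *)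
Lemma mulr_norm_ln_le (R : realType) (s t : R) : 0 <= s -> s <= t ->
  s * (1 + `|ln s|) <= t * (1 + `|ln t|).
Proof.
rewrite le_eqVlt => /predU1P[<- t0|s0 st].
  by rewrite mul0r mulr_ge0// addr_ge0.
have t0 : 0 < t by exact: lt_le_trans st.
have ts : 1 <= t / s by rewrite ler_pdivlMr// mul1r.
have l1 : s * ln (t / s) <= t - s.
  have := @le_ln1Dx R (t / s - 1).
  rewrite (_ : 1 + (t / s - 1) = t / s) => [h|]; last by ring.
  have {}h : ln (t / s) <= t / s - 1 by apply: h; lra.
  apply: (le_trans (ler_wpM2l (ltW s0) h)).
  by rewrite le_eqVlt; apply/orP; left; apply/eqP; field; rewrite gt_eqF.
have l0 : 0 <= ln (t / s) by exact: ln_ge0.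
have e : ln s = ln t - ln (t / s).
  by rewrite ln_div ?posrE//; ring.
have h1 : `|ln s| <= `|ln t| + ln (t / s).
  by rewrite e (le_trans (ler_normB _ _))// (ger0_norm l0).
have h2 : s * `|ln s| <= s * `|ln t| + s * ln (t / s).
  by rewrite -mulrDr ler_wpM2l// ltW.
have h3 : s * `|ln t| <= t * `|ln t| by rewrite ler_wpM2r.
lra.
Qed.

Lemma entry_le_frob (R : realType) (M : 'M[R]_2) (i j : 'I_2) : `|M i j| <= frob M.
Proof.
rewrite -sqrtr_sqr /frob ler_wsqrtr//.
rewrite (bigD1 i)//= (bigD1 j)//= -addrA lerDl addr_ge0 ?sumr_ge0//.
  by move=> k _; exact: sqr_ge0.
by move=> k _; apply: sumr_ge0 => l _; exact: sqr_ge0.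
Qed.

Section untruncated.
Context (R : realType) (q w : R).
Hypothesis w0 : 0 < w.

Lemma cone_left c (x : R * R) : x.1 <= 0 -> ~ cone w c x.
Proof. by move=> xn [/andP[]]; rewrite ltNge xn. Qed.

Lemma cone_right c (x : R * R) : w <= x.1 -> ~ cone w c x.
Proof. by move=> xn [/andP[_]]; rewrite ltNge xn. Qed.

Lemma wall_left (x : R * R) : x.1 < 0 -> wall_a q w x = 0 /\ wall_b q w x = 0.
Proof.
move=> xn; have xc := cone_left (c := ctr w x.2) (ltW xn).
rewrite /wall_a /wall_b /cell_b /cone_a /cone_b !indicE memNset//.
rewrite memNset ?mul0r ?addr0 ?mulr0// => -[/=].
by rewrite in_itv/= andbT leNgt (lt_trans xn).
Qed.

Lemma wall_right (x : R * R) : w <= x.1 -> wall_a q w x = 0 /\ wall_b q w x = q.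
Proof.
move=> xn; have xc := cone_right (c := ctr w x.2) xn.
rewrite /wall_a /wall_b /cell_b /cone_a /cone_b !indicE memNset//.
rewrite mem_set ?mul0r ?add0r ?mulr0 ?mulr1//; split; rewrite /= in_itv/= ?xn//.
by have /andP[h1 h2] := ctrP w0 x.2; apply/andP; split; lra.
Qed.
End untruncated.

Section rows.
Context (R : realType) (lambda tau : R).
Hypotheses (lambda0 : 0 < lambda) (tau0 : 0 < tau).

Let W (eps L q : R) := wall_const lambda tau * eps * L * (`|q| * (1 + `|ln `|q| |)).

(** The components of [X] are the width beyond which the jump is complete, the size
    from which the bound holds, and the two entries of the row. In
    [square L] the wall coincides with a truncated one reaching above [L]. *)
Lemma infinite_wall (eps q : R) : 0 < eps ->
  exists X : (R * R) * ((R * R -> R) * (R * R -> R)),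
  [/\ 0 < X.1.1,
      forall x, x.1 < 0 -> X.2.1 x = 0 /\ X.2.2 x = 0,
      forall x, X.1.1 <= x.1 -> X.2.1 x = 0 /\ X.2.2 x = q &
      forall L, X.1.2 < L -> exists (a b : R * R -> R) (F : set (R * R)),
        (forall x, square L x -> X.2.1 x = a x /\ X.2.2 x = b x) /\
        row_competitor lambda tau eps L q a b F (W eps L q)].
Proof.
move=> eps0; have [->|q0] := eqVneq q 0.
  exists ((1, 0), (cst 0, cst 0)); split => // L _.
  exists (cst 0), (cst 0), set0; split => //.
  by rewrite /W normr0 mul0r mulr0; exact: zero_row.
have [h wh rowP] := wall_row lambda0 tau0 eps0 q0.
set w := half_cell tau eps q in wh rowP.
have w0 : 0 < w.
  have q2 : 0 < 2 * `|q| by rewrite mulr_gt0// normr_gt0.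
  by apply: divr_gt0 => //; exact: mulr_gt0.
clearbody w.
exists ((w, h), (wall_a q w, wall_b q w)); split => //=.
- exact: wall_left.
- exact: wall_right.
move=> L hL; pose N := (Num.truncn (L / (2 * w))).+1.
have L0 : 0 < L by rewrite (lt_trans _ hL)// (lt_le_trans _ wh)// mulr_gt0.
have Lw0 : 0 <= L / (2 * w) by rewrite divr_ge0 ?mulr_ge0// ltW.
have N1 : N%:R <= L / (2 * w) + 1.
  by rewrite /N -natr1 lerD2r truncn_le.
have N2 : L / (2 * w) < N%:R by rewrite /N truncnS_gt.
have YL : L <= wallY w N.
  rewrite /wallY -natr1 natrM; move: N2; rewrite ltr_pdivrMr ?mulr_gt0// => N2.
  by move: w0 => w0'; nra.
exists (wallN_a q w N), (wallN_b q w N),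
  (wall_sing w N (Num.min (wallY w N) (L - lambda * eps))); split.
  move=> x [_ /=]; rewrite in_itv/= => /andP[h1 h2].
  rewrite wallN_aE// wallN_bE// ifT ?ifT//; apply/andP; split; lra.
apply: rowP => //; move: w0 => w0'; lra.
Qed.

(** The components of [X] are the size [L'] of the inner square, the singular
    set and the row. *)
Lemma finite_wall (q : R) : exists h : R, forall L, h < L ->
  exists X : (R * set (R * R)) * ((R * R -> R) * (R * R -> R)),
  [/\ X.1.1 < L,
      forall x, ~ square X.1.1 x ->
        X.2.1 x = 0 /\ X.2.2 x = q * \1_(`[0, +oo[ `*` setT) x &
      row_competitor lambda tau 1 L q X.2.1 X.2.2 X.1.2 (W 1 L q)].
Proof.
have [->|q0] := eqVneq q 0.
  exists 0 => L L0; exists ((0, set0), (cst 0, cst 0)); split => //=.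
    by move=> x _; rewrite mul0r.
  by rewrite /W normr0 mul0r mulr0; exact: zero_row.
have [h wh rowP] := wall_row lambda0 tau0 (@ltr01 R) q0.
set w := half_cell tau 1 q in wh rowP.
have w0 : 0 < w.
  have q2 : 0 < 2 * `|q| by rewrite mulr_gt0// normr_gt0.
  by apply: divr_gt0 => //; exact: mulr_gt0.
clearbody w.
exists (h + 4 * w) => L hL.
(* The truncation height (2 n - 3) w lies between L - 5 w and L - 3 w, so that
   one half-cell above it is still below L. *)
pose n := Num.truncn (L / (2 * w)); pose N := (n - 2)%N.
have hL' : h < L by move: w0 => w0'; lra.
have L0 : 0 < L by rewrite (lt_trans _ hL')// (lt_le_trans _ wh)// mulr_gt0.
have Lw0 : 0 <= L / (2 * w) by rewrite divr_ge0 ?mulr_ge0// ltW.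
have n1 : n%:R <= L / (2 * w) by rewrite truncn_le.
have n2 : L / (2 * w) < n%:R + 1 by rewrite natr1 truncnS_gt.
have n3 : (2 <= n)%N.
  rewrite truncn_ge_nat// ler_pdivlMr ?mulr_gt0//; move: w0 => w0'; lra.
have NE : N%:R = n%:R - 2 :> R by rewrite natrB.
move: n1 n2; rewrite ler_pdivlMr ?ltr_pdivrMr ?mulr_gt0// => n1 n2.
have YE : wallY w N = 2 * n%:R * w - 3 * w.
  by rewrite /wallY -natr1 natrM NE; ring.
have Y0 : 0 < wallY w N by rewrite /wallY mulr_gt0.
exists ((wallY w N + w, wall_sing w N (Num.min (wallY w N) (L - lambda * 1))),
  (wallN_a q w N, wallN_b q w N)); split => /=.
- by rewrite YE; move: w0 => w0'; nra.
- move=> x xo; rewrite wallN_aE// wallN_bE// indic_halfplane.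
  case: ifPn => yY; last by case: ifP; rewrite ?mulr1 ?mulr0.
  have [xn|xp] := ltP x.1 0; first by rewrite mulr0; exact: wall_left.
  rewrite mulr1; apply: wall_right => //.
  rewrite leNgt; apply/negP => xw; apply: xo; move: w0 Y0 => w0' Y0'.
  by case/andP: yY => h1 h2; split; rewrite /= in_itv/=; apply/andP; split; lra.
- apply: rowP => //; first by rewrite NE ler_wpDr// lerBlDr ler_wpDr// ler_pdivlMr ?mulr_gt0.
  by rewrite YE; move: w0 => w0'; nra.
Qed.
End rows.

(** * The grain boundary *)

Lemma compact_sub_square (R : realType) (K : set (R * R)) : compact K ->
  exists M, forall L, M < L -> K `<=` square L.
Proof.
move=> /compact_bounded[M [_ MK]]; exists (`|M| + 1) => L ML x Kx.
have xM : `|x| <= `|M| + 1.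
  apply: (MK (`|M| + 1)) => //.
  by rewrite (le_lt_trans (ler_norm M))// ltrDl.
have xL : `|x| < L by exact: le_lt_trans ML.
have [h1 h2] : `|x.1| < L /\ `|x.2| < L.
  by move: xL; rewrite /Num.norm/= gt_max => /andP[].
by split; rewrite /= in_itv/= -ltr_norml.
Qed.

Lemma measurable_compact2 (R : realType) (K : set (R * R)) : compact K ->
  measurable (K : set (measurableTypeR R * measurableTypeR R)).
Proof.
move=> cK; rewrite -[K]setCK; apply: measurableC; apply: measurable_open2.
apply: closed_openC; apply: compact_closed => //; exact: norm_hausdorff.
Qed.

Definition two_row_field (R : realType) (Rm Rp : 'M[R]_2)
    (a b : 'I_2 -> R * R -> R) (x : R * R) : 'M[R]_2 :=
  \matrix_(i, j) if j == 0
    then Rm i 0 + (Rp - Rm) i 0 * \1_(`[0, +oo[ `*` setT) x + a i x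
    else Rm i 1 + b i x.

Lemma two_row_field_rot (R : realType) (Rm Rp : 'M[R]_2)
    (a b : 'I_2 -> R * R -> R) (x : R * R) :
  (forall i, a i x = 0 /\
     b i x = (Rp - Rm) i 1 * \1_(`[0, +oo[ `*` setT) x) ->
  two_row_field Rm Rp a b x = two_rot Rm Rp x.
Proof.
move=> h; apply/matrixP => i j; have [e1 e2] := h i.
rewrite /two_row_field mxE e1 e2 /two_rot addr0 indic_halfplane.
by have [->|->] := ord2_cases j; case: ltP => _ /=; rewrite !mxE; ring.
Qed.

Section two_walls.
Context (R : realType) (lambda tau : R).
Hypotheses (lambda0 : 0 < lambda) (tau0 : 0 < tau).
Variables (Rm Rp : 'M[R]_2).
Hypotheses (SRm : SO2 Rm) (SRp : SO2 Rp).
Let theta := frob (Rm - Rp).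
Let C := 4 * wall_const lambda tau.

Lemma two_walls_Feps (eps L : R) (a b a' b' : 'I_2 -> R * R -> R)
    (F : 'I_2 -> set (R * R)) : 0 < eps -> 0 < L ->
  (forall i x, square L x -> a i x = a' i x /\ b i x = b' i x) ->
  (forall i, row_competitor lambda tau eps L ((Rp - Rm) i 1) (a' i) (b' i) (F i)
     (wall_const lambda tau * eps * L *
       (`|(Rp - Rm) i 1| * (1 + `|ln `|(Rp - Rm) i 1| |)))) ->
  L1 (square L) (two_row_field Rm Rp a b) /\
  (Feps lambda tau eps (two_row_field Rm Rp a b) (square L) <=
    (C * L * theta * (`|ln theta| + 1))%:E)%E.
Proof.
move=> eps0 L0 ab rows.
have A0 x i : square L x -> two_row_field Rm Rp a b x i 0 =
    Rm i 0 + (Rp - Rm) i 0 * \1_(`[0, +oo[ `*` setT) x + a' i x.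
  by move=> xL; rewrite /two_row_field mxE/= (ab i x xL).1.
have A1 x i : square L x -> two_row_field Rm Rp a b x i 1 = Rm i 1 + b' i x.
  by move=> xL; rewrite /two_row_field mxE/= (ab i x xL).2.
split; first exact: (two_rows_L1 rows A0 A1).
apply: (le_trans (two_rows_Feps rows SRm SRp A0 A1 eps0)).
rewrite lee_fin.
have qt i : `|(Rp - Rm) i 1| * (1 + `|ln `|(Rp - Rm) i 1| |) <= theta * (1 + `|ln theta|).
  apply: mulr_norm_ln_le => //; rewrite /theta -normrN.
  by apply: (le_trans _ (entry_le_frob (Rm - Rp) i 1)); rewrite !mxE opprB.
have W0 := wall_const_gt0 lambda0 tau0.
have h i : wall_const lambda tau * eps * L *
       (`|(Rp - Rm) i 1| * (1 + `|ln `|(Rp - Rm) i 1| |)) <=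
   wall_const lambda tau * eps * L * (theta * (1 + `|ln theta|)).
  by apply: ler_wpM2l => //; rewrite !mulr_ge0// ltW.
rewrite ler_pdivrMl//.
have := lerD (h 0) (h 1).
rewrite (_ : eps * (C * L * theta * (`|ln theta| + 1)) =
  2 * (wall_const lambda tau * eps * L * (theta * (1 + `|ln theta|)) +
   wall_const lambda tau * eps * L * (theta * (1 + `|ln theta|)))).
  by move=> h'; rewrite ler_wpM2l.
by rewrite /C; ring.
Qed.

Lemma grain_boundary_field (eps : R) : 0 < eps ->
  exists (l h : R) (A : R * R -> 'M[R]_2),
    [/\ 0 < l, 0 < h, L1loc A,
        forall x : R * R, ~ (`]- (l / 2), l / 2[ `*` [set: R]) x ->
          A x = two_rot Rm Rp x &
        forall L : R, h < L ->
          (Feps lambda tau eps A (square L)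
             <= (C * L * theta * (`|ln theta| + 1))%:E)%E].
Proof.
move=> eps0.
have [X XP] := choice (fun i : 'I_2 =>
  infinite_wall lambda0 tau0 ((Rp - Rm) i 1) eps0).
pose l := 2 * Num.max (X 0).1.1 (X 1).1.1.
pose h := `|Num.max (X 0).1.2 (X 1).1.2| + 1.
pose A := two_row_field Rm Rp (fun i => (X i).2.1) (fun i => (X i).2.2).
have h0 : 0 < h by rewrite /h ltr_wpDl.
have lX i : (X i).1.1 <= l / 2.
  rewrite /l mulrC mulKf// le_max.
  by have [->|->] := ord2_cases i; rewrite lexx ?orbT.
have hX i : (X i).1.2 < h.
  rewrite /h (@le_lt_trans _ _ `|Num.max (X 0).1.2 (X 1).1.2|)// ?ltrDl//.
  rewrite (le_trans _ (ler_norm _))// le_max.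
  by have [->|->] := ord2_cases i; rewrite lexx ?orbT.
have l0 : 0 < l / 2.
  by have [+ _ _ _] := XP 0; move=> /lt_le_trans; apply; exact: lX.
have FL L : h < L -> L1 (square L) A /\
  (Feps lambda tau eps A (square L) <= (C * L * theta * (`|ln theta| + 1))%:E)%E.
  move=> hL.
  have [Y YP] : exists Y : 'I_2 -> (R * R -> R) * (R * R -> R) * set (R * R),
    forall i, (forall x, square L x -> (X i).2.1 x = (Y i).1.1 x /\
       (X i).2.2 x = (Y i).1.2 x) /\
     row_competitor lambda tau eps L ((Rp - Rm) i 1) (Y i).1.1 (Y i).1.2 (Y i).2
     (wall_const lambda tau * eps * L *
       (`|(Rp - Rm) i 1| * (1 + `|ln `|(Rp - Rm) i 1| |))).
    have ex i : exists Y : (R * R -> R) * (R * R -> R) * set (R * R),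
        (forall x, square L x -> (X i).2.1 x = Y.1.1 x /\
           (X i).2.2 x = Y.1.2 x) /\
        row_competitor lambda tau eps L ((Rp - Rm) i 1) Y.1.1 Y.1.2 Y.2
         (wall_const lambda tau * eps * L *
         (`|(Rp - Rm) i 1| * (1 + `|ln `|(Rp - Rm) i 1| |))).
      have [_ _ _ /(_ L (lt_trans (hX i) hL)) [a [b [F FP]]]] := XP i.
      by exists (a, b, F).
    by have [Y YP] := choice ex; exists Y.
  apply: (two_walls_Feps (F := fun i => (Y i).2) eps0 (lt_trans h0 hL)).
    by move=> i; exact: (YP i).1.
  by move=> i; exact: (YP i).2.
exists l, h, A; split => //.
- by move: l0; lra.
- move=> K cK i j; have [M MK] := compact_sub_square cK.
  pose L := Num.max h M + 1.
  have hL : h < L by rewrite /L ltr_pwDr// le_max lexx.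
  have ML : M < L by rewrite /L ltr_pwDr// le_max lexx orbT.
  apply: integrableS ((FL L hL).1 i j).
  + exact: measurable_square.
  + exact: measurable_compact2.
  + exact: MK.
- move=> x xl; apply: two_row_field_rot => i.
  have [_ P1 P2 _] := XP i.
  have [xn|xp] := ltP x.1 0.
    by rewrite indic_halfplane [0 <= x.1]leNgt xn mulr0; exact: P1.
  rewrite indic_halfplane xp mulr1.
  apply: P2; rewrite leNgt; apply/negP => xX; apply: xl; split => //=.
  by have lx := lX i; rewrite in_itv/=; apply/andP; split; lra.
- by move=> L /FL[].
Qed.

Lemma psi_le : exists h, forall L, h < L ->
  (psi lambda tau Rm Rp L <= (C * L * theta * (`|ln theta| + 1))%:E)%E.
Proof.
have [h hP] := choice (fun i : 'I_2 => finite_wall lambda0 tau0 ((Rp - Rm) i 1)).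
exists (`|Num.max (h 0) (h 1)|) => L hL.
have hX i : h i < L.
  rewrite (le_lt_trans _ hL)// (le_trans _ (ler_norm _))// le_max.
  by have [->|->] := ord2_cases i; rewrite lexx ?orbT.
have L0 : 0 < L by exact: le_lt_trans hL.
have [X XP] := choice (fun i => hP i L (hX i)).
pose A := two_row_field Rm Rp (fun i => (X i).2.1) (fun i => (X i).2.2).
have [_ FL] : L1 (square L) A /\
  (Feps lambda tau 1 A (square L) <= (C * L * theta * (`|ln theta| + 1))%:E)%E.
  apply: (two_walls_Feps (F := fun i => (X i).1.2) (@ltr01 R) L0).
    by move=> i.
  by move=> i; have [_ _] := XP i.
apply: (le_trans _ FL); apply: ereal_inf_lbound; exists A => //; split.
  move=> K cK i j; have [M MK] := compact_sub_square cK.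
  have A0 x k : A x k 0 = Rm k 0 + (Rp - Rm) k 0 * \1_(`[0, +oo[ `*` setT) x + (X k).2.1 x.
    by rewrite /A /two_row_field mxE.
  have A1 x k : A x k 1 = Rm k 1 + (X k).2.2 x.
    by rewrite /A /two_row_field mxE.
  have li : loc_int (fun x => A x i j).
    have [_ _ rk] := XP i.
    have [->|->] := ord2_cases j.
      rewrite (_ : (fun x => _) = ((cst (Rm i 0) : R * R -> R) \+
         (fun x => (Rp - Rm) i 0 * \1_(`[0, +oo[ `*` setT) x)) \+ (X i).2.1).
        apply: loc_intD; last exact: row_int_a rk.
        apply: loc_intD; first exact: loc_int_cst.
        by apply: loc_intZ; apply: loc_int_indic; exact: measurable_halfplane.
      by apply/funext => x; rewrite A0.
    rewrite (_ : (fun x => _) = (cst (Rm i 1) : R * R -> R) \+ (X i).2.2).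
      by apply: loc_intD; [exact: loc_int_cst|exact: row_int_b rk].
    by apply/funext => x; rewrite A1.
  apply: integrableS (li (M + 1)).
  + exact: measurable_square.
  + exact: measurable_compact2.
  + by apply: MK; rewrite ltrDl.
exists (Num.max (X 0).1.1 (X 1).1.1).
  by rewrite gt_max; have [-> _ _] := XP 0; have [-> _ _] := XP 1.
move=> x xo; apply: two_row_field_rot => i.
have [_ + _] := XP i; apply => xi; apply: xo.
have le : (X i).1.1 <= Num.max (X 0).1.1 (X 1).1.1.
  by rewrite le_max; have [->|->] := ord2_cases i; rewrite lexx ?orbT.
by case: xi => /= + +; rewrite !in_itv/= => /andP[? ?] /andP[? ?];
  split; rewrite /= in_itv/=; apply/andP; split; lra.
Qed.

(** Only the eventual bound on [psi] matters: it passes to the limit, and the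
    limit of a divergent function is, by convention, 0, which the nonnegative right-hand side
    dominates. *)
Lemma psi_oo_le :
  (psi_oo lambda tau Rm Rp <= (C * theta * (`|ln theta| + 1))%:E)%E.
Proof.
have t0 : 0 <= theta by exact: sqrtr_ge0.
have W0 := wall_const_gt0 lambda0 tau0.
have C0 : 0 <= C * theta * (`|ln theta| + 1).
  apply: mulr_ge0; last by rewrite addr_ge0.
  by apply: mulr_ge0 => //; rewrite /C mulr_ge0// ltW.
have [h hP] := psi_le.
rewrite /psi_oo.
set f := fun L : R => _.
have [cv|ncv] := pselect (cvg (f L @[L --> +oo%R])); last first.
  rewrite [lim _]getPN; first by rewrite lee_fin.
  by move=> l hl; apply: ncv; apply/cvg_ex; exists l.
apply: (lime_le cv).
near=> L.
have hL : h < L by near: L; apply: nbhs_pinfty_gt; exact: num_real.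
have L0 : 0 < L by near: L; apply: nbhs_pinfty_gt; exact: num_real.
rewrite /f; apply: (le_trans (lee_wpmul2l _ (hP L hL))).
  by rewrite lee_fin invr_ge0 mulr_ge0// ltW.
rewrite -EFinM lee_fin [leLHS](_ : _ = (C * theta * (`|ln theta| + 1)) / 2).
  by rewrite ler_pdivrMr// ler_peMr// ler1n.
by field; rewrite gt_eqF.
Unshelve. all: by end_near. Qed.

End two_walls.

Theorem proposition5p2 (R : realType) (lambda tau : R)
    (lambda_gt0 : 0 < lambda) (tau_gt0 : 0 < tau) :
  exists C : R, 0 < C /\
    (forall Rm Rp : 'M[R]_2, SO2 Rm -> SO2 Rp ->
     forall eps : R, 0 < eps ->
     exists (l h : R) (A : R * R -> 'M[R]_2),
       [/\ 0 < l, 0 < h, L1loc A,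
           forall x : R * R, ~ (`]- (l / 2), l / 2[ `*` [set: R]) x ->
             A x = two_rot Rm Rp x &
           forall L : R, h < L ->
             (Feps lambda tau eps A (square L)
                <= (C * L * frob (Rm - Rp)
                      * (`|ln (frob (Rm - Rp))| + 1))%:E)%E]) /\
    (forall Rm Rp : 'M[R]_2, SO2 Rm -> SO2 Rp ->
       (psi_oo lambda tau Rm Rp
          <= (C * frob (Rm - Rp) * (`|ln (frob (Rm - Rp))| + 1))%:E)%E).
Proof.
exists (4 * wall_const lambda tau); split.
  by rewrite mulr_gt0// wall_const_gt0.
split=> [Rm Rp Sm Sp eps eps0|Rm Rp Sm Sp].
  exact: grain_boundary_field.
exact: psi_oo_le.
Qed.
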